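(* Let $k$ be a commutative ring and let $\mathcal C$ be a cooperad with comultiplication in $k$-modules, with its differential $d$, its cobrace $[-]$, and its cobracket $\{-\}:=(\mathrm{id}-\rho)\circ[-]$, all as recalled in the context. Then the suspended complex $(\mathcal C_\bullet[1],d,\{-\})$, in which $\mathcal C(n)$ sits in degree $n-1$, is a dg Lie coalgebra.
   Context: Tensor products are over $k$, and $k\otimes M\cong M\cong M\otimes k$ is used implicitly. A planar counital cooperad is a sequence $\mathcal C=\{\mathcal C(n)\}_{n\ge0}$ of $k$-modules with $k$-linear maps $\epsilon\colon\mathcal C(1)\to k$ and $\Delta_{p,q,i}\colon\mathcal C(p+q-1)\to\mathcal C(p)\otimes\mathcal C(q)$ for $p\ge1$, $q\ge0$, $1\le i\le p$ (and $\Delta_{0,q,i}:=0$), such that $(\epsilon\otimes\mathrm{id})\circ\Delta_{1,n,1}=\mathrm{id}_{\mathcal C(n)}$, $(\mathrm{id}\otimes\epsilon)\circ\Delta_{n,1,i}=\mathrm{id}_{\mathcal C(n)}$ for $1\le i\le n$, and for all $p\ge 1$, $q,r\ge0$, $1\le i\le p$, $1\le j\le p+q-1$: $$(\Delta_{p,q,i}\otimes\mathrm{id})\circ\Delta_{p+q-1,r,j}=\begin{cases}(\mathrm{id}\otimes\sigma)\circ(\Delta_{p,r,j-q+1}\otimes\mathrm{id})\circ\Delta_{p+r-1,q,i}& i\le j-q,\\(\mathrm{id}\otimes\Delta_{q,r,j-i+1})\circ\Delta_{p,q+r-1,i}& j-q<i\le j,\\(\mathrm{id}\otimes\sigma)\circ(\Delta_{p,r,j}\otimes\mathrm{id})\circ\Delta_{p+r-1,q,i+r-1}&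 j<i\le p,\end{cases}$$ where $\sigma(a\otimes b)=b\otimes a$. A cooperad with comultiplication is a planar counital cooperad $\mathcal C$ with a morphism of counital cooperads to the linear dual of the unital associative operad; equivalently, with $k$-linear maps $\mu^c\colon\mathcal C(2)\to k$ and $e^c\colon\mathcal C(0)\to k$ such that $(\mu^c\otimes\mu^c)\circ\Delta_{2,2,1}=(\mu^c\otimes\mu^c)\circ\Delta_{2,2,2}$ and $(\mu^c\otimes e^c)\circ\Delta_{2,0,1}=(\mu^c\otimes e^c)\circ\Delta_{2,0,2}=\epsilon$. Differential: on $\mathcal C(n)$, $n\geq 1$, $d=(\mu^c\otimes\mathrm{id})\circ\big(\Delta_{2,n-1,2}+(-1)^n\Delta_{2,n-1,1}\big)+\sum_{i=1}^{n-1}(-1)^i(\mathrm{id}\otimes\mu^c)\circ\Delta_{n-1,2,i}\colon\mathcal C(n)\to\mathcal C(n-1)$ and $d=0$ on $\mathcal C(0)$. Cobrace: for $x\in\mathcal C(n)$, $[x]=\sum_{p=1}^{n+1}\sum_{i=1}^{p}(-1)^{(n-p)(p-i)}\Delta_{p,n+1-p,i}(x)$. Flip: $\rho(a\otimes b)=(-1)^{(p-1)(q-1)}b\otimes a$ for $a\in\mathcal C(p)$, $b\in\mathcal C(q)$; this is the graded flip for the suspended grading. A dg Lie coalgebra is a chain complex $(L,d)$ with a map of chain complexes $\{-\}\colon L\to L\otimes L$ such that, with $\tau(a\otimes b)=(-1)^{|a||b|}b\otimes a$ the graded flip of $L$ (so $\tau=\rho$ for $L=\mathcal C_\bullet[1]$):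 (i) $\{-\}\circ d=\big(d\otimes\mathrm{id}+\tau\circ(d\otimes\mathrm{id})\circ\tau\big)\circ\{-\}$; (ii) $\mathrm{Im}(\{-\})\subseteq\mathrm{Im}(\mathrm{id}-\tau)$; (iii) $\big(\mathrm{id}+(\mathrm{id}\otimes\tau)\circ(\tau\otimes\mathrm{id})+(\tau\otimes\mathrm{id})\circ(\mathrm{id}\otimes\tau)\big)\circ(\{-\}\otimes\mathrm{id})\circ\{-\}=0$. *)

(* Defs.v *)
From HB Require Import structures.
From mathcomp Require Import all_boot all_order all_algebra.
From mathcomp Require Import generic_quotient.
From mathcomp Require Import boolp classical_sets cardinality fsbigop.

Set Implicit Arguments.
Unset Strict Implicit.
Unset Printing Implicit Defensive.

Import GRing.Theory.
Local Open Scope ring_scope.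
Local Open Scope quotient_scope.

Section Tensor.
Context {k : comPzRingType} {U V : lmodType k}.

(* U ⊗ V is the monoid of finite formal sums of symbols (u, v), i.e. of lists
   under concatenation, modulo the least congruence making concatenation
   commutative and (u, v) balanced, additive in each variable, and zero
   whenever u is. *)
Inductive tensor_eq : seq (U * V) -> seq (U * V) -> Prop :=
| tensor_eq_refl s : tensor_eq s s
| tensor_eq_sym s t : tensor_eq s t -> tensor_eq t s
| tensor_eq_trans s t r : tensor_eq s t -> tensor_eq t r -> tensor_eq s r
| tensor_eq_cat s s' t t' :
    tensor_eq s s' -> tensor_eq t t' -> tensor_eq (s ++ t) (s' ++ t')
| tensor_eq_comm s t : tensor_eq (s ++ t) (t ++ s)
| tensor_eq_addl u u' v : tensor_eq [:: (u + u', v)] [:: (u, v); (u', v)]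
| tensor_eq_addr u v v' : tensor_eq [:: (u, v + v')] [:: (u, v); (u, v')]
| tensor_eq_scale a u v : tensor_eq [:: (a *: u, v)] [:: (u, a *: v)]
| tensor_eq_zero v : tensor_eq [:: (0, v)] [::].

Definition tensor_eqb (s t : seq (U * V)) : bool := `[< tensor_eq s t >].

Lemma tensor_eqb_equiv : equiv_class_of tensor_eqb.
Proof.
split=> [s|s t|t s r].
- exact/asboolP/tensor_eq_refl.
- by apply/idP/idP => /asboolP h; apply/asboolP/tensor_eq_sym.
- by move=> /asboolP h1 /asboolP h2; apply/asboolP/(tensor_eq_trans h1 h2).
Qed.

Canonical tensor_equiv := EquivRelPack tensor_eqb_equiv.

Definition tensor := {eq_quot tensor_equiv}.
HB.instance Definition _ := Choice.on tensor.
HB.instance Definition _ := EqQuotient.on tensor.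

Lemma tensor_piP (s t : seq (U * V)) :
  \pi_tensor s = \pi_tensor t <-> tensor_eq s t.
Proof. by split=> [/eqmodP/asboolP//|h]; apply/eqmodP/asboolP. Qed.

Lemma tensor_repr_pi (s : seq (U * V)) : tensor_eq (repr (\pi_tensor s)) s.
Proof. by apply/tensor_piP; rewrite reprK. Qed.

Lemma tensorW (P : tensor -> Prop) : (forall s, P (\pi_tensor s)) -> forall x, P x.
Proof. by move=> h x; rewrite -[x]reprK. Qed.

Definition tensor_add (x y : tensor) : tensor := \pi_tensor (repr x ++ repr y).
Definition tensor_opp (x : tensor) : tensor :=
  \pi_tensor [seq (- uv.1, uv.2) | uv <- repr x].
Definition tensor_scale (a : k) (x : tensor) : tensor :=
  \pi_tensor [seq (a *: uv.1, uv.2) | uv <- repr x].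

Lemma tensor_eq_scalemap (a : k) s t : tensor_eq s t ->
  tensor_eq [seq (a *: uv.1, uv.2) | uv <- s] [seq (a *: uv.1, uv.2) | uv <- t].
Proof.
elim=> {s t} /=.
- by move=> s; apply: tensor_eq_refl.
- by move=> s t _ /tensor_eq_sym.
- by move=> s t r _ h1 _; apply: tensor_eq_trans.
- by move=> s s' t t' _ h1 _ h2; rewrite !map_cat; apply: tensor_eq_cat.
- by move=> s t; rewrite !map_cat; apply: tensor_eq_comm.
- by move=> u u' v; rewrite scalerDr; apply: tensor_eq_addl.
- move=> u v v'; exact: tensor_eq_addr.
- by move=> b u v; rewrite scalerA mulrC -scalerA; apply: tensor_eq_scale.
- by move=> v; rewrite scaler0; apply: tensor_eq_zero.
Qed.

Lemma tensor_addE s t :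
  tensor_add (\pi_tensor s) (\pi_tensor t) = \pi_tensor (s ++ t).
Proof. by apply/tensor_piP/tensor_eq_cat; apply: tensor_repr_pi. Qed.

Lemma tensor_scaleE a s :
  tensor_scale a (\pi_tensor s) = \pi_tensor [seq (a *: uv.1, uv.2) | uv <- s].
Proof. exact/tensor_piP/tensor_eq_scalemap/tensor_repr_pi. Qed.

Lemma tensor_oppE x : tensor_opp x = tensor_scale (-1) x.
Proof.
by congr (\pi_tensor _); apply: eq_map => uv; rewrite scaleN1r.
Qed.

Fact tensor_addA : associative tensor_add.
Proof.
move=> x y z; elim/tensorW: x => s; elim/tensorW: y => t; elim/tensorW: z => r.
by rewrite !tensor_addE catA.
Qed.
Fact tensor_addC : commutative tensor_add.
Proof.
move=> x y; elim/tensorW: x => s; elim/tensorW: y => t; rewrite !tensor_addE.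
exact/tensor_piP/tensor_eq_comm.
Qed.
Fact tensor_add0 : left_id (\pi_tensor [::]) tensor_add.
Proof. by move=> x; elim/tensorW: x => s; rewrite tensor_addE. Qed.
Fact tensor_addN : left_inverse (\pi_tensor [::]) tensor_opp tensor_add.
Proof.
move=> x; elim/tensorW: x => s; rewrite tensor_oppE tensor_scaleE tensor_addE.
elim: s => [//|[u v] s IH] /=.
have -> : \pi_tensor ((-1 *: u, v) :: [seq (-1 *: uv.1, uv.2) | uv <- s] ++ (u, v) :: s)
    = tensor_add (\pi_tensor [:: (-1 *: u, v); (u, v)])
        (\pi_tensor ([seq (-1 *: uv.1, uv.2) | uv <- s] ++ s)).
  rewrite tensor_addE; apply/tensor_piP.
  rewrite -cat1s -[X in tensor_eq _ X]/([:: (-1 *: u, v)] ++ (u, v) :: _).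
  apply/tensor_eq_cat; first exact: tensor_eq_refl.
  set t := [seq _ | _ <- s].
  rewrite -[_ :: s]cat1s -[_ :: t ++ s]cat1s !catA.
  by apply/tensor_eq_cat; [apply: tensor_eq_comm | apply: tensor_eq_refl].
rewrite IH tensor_addC tensor_add0 scaleN1r; apply/tensor_piP.
apply: (tensor_eq_trans (tensor_eq_sym (tensor_eq_addl _ _ _))).
by rewrite addNr; apply: tensor_eq_zero.
Qed.

HB.instance Definition _ := GRing.isZmodule.Build tensor
  tensor_addA tensor_addC tensor_add0 tensor_addN.

Fact tensor_scaleA a b x : tensor_scale a (tensor_scale b x) = tensor_scale (a * b) x.
Proof.
elim/tensorW: x => s; rewrite !tensor_scaleE -map_comp; congr (\pi_tensor _).
by apply: eq_map => uv /=; rewrite scalerA.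
Qed.
Fact tensor_scale1 : left_id 1 tensor_scale.
Proof.
move=> x; elim/tensorW: x => s; rewrite tensor_scaleE; congr (\pi_tensor _).
by rewrite -[RHS]map_id; apply: eq_map => -[u v] /=; rewrite scale1r.
Qed.
Fact tensor_scaleDr : right_distributive tensor_scale +%R.
Proof.
move=> a x y; elim/tensorW: x => s; elim/tensorW: y => t.
by rewrite [X in tensor_scale a X]tensor_addE !tensor_scaleE map_cat -tensor_addE.
Qed.
Fact tensor_scaleDl x : {morph tensor_scale^~ x : a b / a + b}.
Proof.
move=> a b; elim/tensorW: x => s; rewrite !tensor_scaleE.
elim: s => [|[u v] s IH] /=.
  by rewrite [RHS]tensor_addE.
rewrite -cat1s -tensor_addE IH.
rewrite -(cat1s (a *: u, v)) -(cat1s (b *: u, v)) -!tensor_addE.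
have -> : \pi_tensor [:: ((a + b) *: u, v)] =
   tensor_add (\pi_tensor [:: (a *: u, v)]) (\pi_tensor [:: (b *: u, v)]).
  by rewrite tensor_addE scalerDl; apply/tensor_piP/tensor_eq_addl.
exact: (addrACA (\pi_tensor [:: (a *: u, v)] : tensor)).
Qed.

HB.instance Definition _ := GRing.Zmodule_isLmodule.Build k tensor
  tensor_scaleA tensor_scale1 tensor_scaleDr tensor_scaleDl.

Definition pure (u : U) (v : V) : tensor := \pi_tensor [:: (u, v)].

Lemma pureDl v : {morph pure^~ v : u u' / u + u'}.
Proof. by move=> u u'; rewrite [RHS]tensor_addE; apply/tensor_piP/tensor_eq_addl. Qed.
Lemma pureDr u : {morph pure u : v v' / v + v'}.
Proof. by move=> v v'; rewrite [RHS]tensor_addE; apply/tensor_piP/tensor_eq_addr. Qed.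
Lemma pureZl a u v : pure (a *: u) v = a *: pure u v.
Proof. by rewrite [RHS]tensor_scaleE. Qed.
Lemma pureZr a u v : pure u (a *: v) = a *: pure u v.
Proof. by rewrite -pureZl; apply/tensor_piP/tensor_eq_sym/tensor_eq_scale. Qed.

Lemma pure0l v : pure 0 v = 0.
Proof. by rewrite -(scale0r (0 : U)) pureZl scale0r. Qed.
Lemma pure0r u : pure u 0 = 0.
Proof. by rewrite -(scale0r (0 : V)) pureZr scale0r. Qed.
Lemma pure_suml (T : Type) (s : seq T) (f : T -> U) v :
  pure (\sum_(t <- s) f t) v = \sum_(t <- s) pure (f t) v.
Proof. exact: (big_morph (pure^~ v) (pureDl v) (pure0l v)). Qed.
Lemma pure_sumr (T : Type) (s : seq T) u (f : T -> V) :
  pure u (\sum_(t <- s) f t) = \sum_(t <- s) pure u (f t).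
Proof. exact: (big_morph (pure u) (pureDr u) (pure0r u)). Qed.

Lemma pureP (x : tensor) : exists s : seq (U * V), x = \sum_(uv <- s) pure uv.1 uv.2.
Proof.
elim/tensorW: x => s; exists s; elim: s => [|[u v] s IH]; first by rewrite big_nil.
by rewrite big_cons -IH -cat1s -tensor_addE.
Qed.

Definition bilin (W : lmodType k) (B : U -> V -> W) : Prop :=
  (forall v, linear (B^~ v)) /\ (forall u, linear (B u)).

Lemma pure_bilin : bilin pure.
Proof.
by split=> [v|u] a x y; rewrite ?(pureDl, pureDr) ?(pureZl, pureZr).
Qed.

Section Lift.
Context {W : lmodType k} (B : U -> V -> W) (hB : bilin B).

Definition tlift of bilin B := fun x : tensor => \sum_(uv <- repr x) B uv.1 uv.2.

Lemma tlift_eq s t : tensor_eq s t ->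
  \sum_(uv <- s) B uv.1 uv.2 = \sum_(uv <- t) B uv.1 uv.2.
Proof.
have [hl hr] := hB.
have Dl u u' v : B (u + u') v = B u v + B u' v.
  by have := hl v 1 u u'; rewrite !scale1r.
have Dr u v v' : B u (v + v') = B u v + B u v'.
  by have := hr u 1 v v'; rewrite !scale1r.
have z v : B 0 v = 0 by apply: (addrI (B 0 v)); rewrite -Dl !addr0.
have z' u : B u 0 = 0 by apply: (addrI (B u 0)); rewrite -Dr !addr0.
elim=> {s t} //=.
- by move=> s t r _ -> _.
- by move=> s s' t t' _ h1 _ h2; rewrite !big_cat h1 h2.
- by move=> s t; rewrite !big_cat /= addrC.
- by move=> u u' v; rewrite !big_cons !big_nil !addr0 Dl.
- by move=> u v v'; rewrite !big_cons !big_nil !addr0 Dr.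
- move=> a u v; rewrite !big_cons !big_nil !addr0 /=.
  by have := hl v a u 0; have := hr u a v 0; rewrite !addr0 z z' !addr0 => -> ->.
- by move=> v; rewrite !big_cons !big_nil addr0.
Qed.

Lemma tlift_pi s : tlift hB (\pi_tensor s) = \sum_(uv <- s) B uv.1 uv.2.
Proof. exact/tlift_eq/tensor_repr_pi. Qed.

Lemma tlift_linear : linear (tlift hB).
Proof.
have [hl hr] := hB.
move=> a x y; elim/tensorW: x => s; elim/tensorW: y => t.
rewrite [a *: _]tensor_scaleE [_ + _]tensor_addE !tlift_pi big_cat big_map /=.
congr (_ + _); rewrite scaler_sumr; apply: eq_bigr => uv _.
have := hl uv.2 a uv.1 0; rewrite addr0 => ->.
suff -> : B 0 uv.2 = 0 by rewrite addr0.
have := hl uv.2 1 0 0; rewrite !scale1r addr0 => h.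
by apply: (addrI (B 0 uv.2)); rewrite -h addr0.
Qed.

HB.instance Definition _ := GRing.isLinear.Build k tensor W *:%R (tlift hB) tlift_linear.

Lemma tliftE u v : tlift hB (pure u v) = B u v.
Proof. by rewrite tlift_pi big_seq1. Qed.

Lemma tlift_sum (s : seq (U * V)) :
  tlift hB (\sum_(uv <- s) pure uv.1 uv.2) = \sum_(uv <- s) B uv.1 uv.2.
Proof. by rewrite linear_sum; apply: eq_bigr => uv _; apply: tliftE. Qed.

End Lift.

Lemma tensor_linear_ext (W : lmodType k) (f g : {linear tensor -> W}) :
  (forall u v, f (pure u v) = g (pure u v)) -> f =1 g.
Proof.
move=> h x; have [s ->] := pureP x; rewrite !linear_sum.
by apply: eq_bigr => uv _; apply: h.
Qed.

End Tensor.

Arguments tensor {k} U V.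

Section TensorMaps.
Context {k : comPzRingType}.
Implicit Types U V W : lmodType k.

Lemma tmap_bilin U U' V V' (f : {linear U -> U'}) (g : {linear V -> V'}) :
  bilin (fun u v => pure (f u) (g v)).
Proof.
by split=> [v|u] a x y /=; rewrite linearP ?(pureDl, pureDr) ?(pureZl, pureZr).
Qed.
Definition tmap U U' V V' (f : {linear U -> U'}) (g : {linear V -> V'}) :=
  tlift (tmap_bilin f g).
HB.instance Definition _ U U' V V' (f : {linear U -> U'}) (g : {linear V -> V'}) :=
  GRing.Linear.on (tmap f g).

Lemma tswap_bilin U V : bilin (fun (u : U) (v : V) => pure v u).
Proof. by case: (@pure_bilin k V U). Qed.
Definition tswap U V := tlift (@tswap_bilin U V).
HB.instance Definition _ U V := GRing.Linear.on (@tswap U V).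

Lemma tassoc_bilin1 U V W (w : W) :
  bilin (fun (u : U) (v : V) => pure u (pure v w)).
Proof.
by split=> [v|u] a x y /=; rewrite !(pureDl, pureDr) !(pureZl, pureZr).
Qed.
Lemma tassoc_bilin U V W :
  bilin (fun (x : tensor U V) (w : W) => tlift (@tassoc_bilin1 U V W w) x).
Proof.
split=> [w|x] a y z; first exact: linearP.
have [s ->] := pureP x; rewrite !tlift_sum scaler_sumr -big_split /=.
by apply: eq_bigr => uv _; rewrite !(pureDl, pureDr) !(pureZl, pureZr).
Qed.
Definition tassoc U V W : tensor (tensor U V) W -> tensor U (tensor V W) :=
  tlift (@tassoc_bilin U V W).
HB.instance Definition _ U V W := GRing.Linear.on (@tassoc U V W).

Lemma tassocV_bilin1 U V W (u : U) :
  bilin (fun (v : V) (w : W) => pure (pure u v) w).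
Proof.
by split=> [w|v] a x y /=; rewrite !(pureDl, pureDr) !(pureZl, pureZr).
Qed.
Lemma tassocV_bilin U V W :
  bilin (fun (u : U) (x : tensor V W) => tlift (@tassocV_bilin1 U V W u) x).
Proof.
split=> [x|u] a y z; last exact: linearP.
have [s ->] := pureP x; rewrite !tlift_sum scaler_sumr -big_split /=.
by apply: eq_bigr => uv _; rewrite !(pureDl, pureDr) !(pureZl, pureZr).
Qed.
Definition tassocV U V W : tensor U (tensor V W) -> tensor (tensor U V) W :=
  tlift (@tassocV_bilin U V W).
HB.instance Definition _ U V W := GRing.Linear.on (@tassocV U V W).

Lemma lunit_bilin U : bilin (fun (a : k^o) (u : U) => a *: u).
Proof.
split=> [u|b] a x y /=; first by rewrite scalerDl scalerA.
by rewrite scalerDr !scalerA mulrC.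
Qed.
Definition lunit U : tensor k^o U -> U := tlift (@lunit_bilin U).
HB.instance Definition _ U := GRing.Linear.on (@lunit U).

Lemma runit_bilin U : bilin (fun (u : U) (a : k^o) => a *: u).
Proof. by case: (@lunit_bilin U). Qed.
Definition runit U : tensor U k^o -> U := tlift (@runit_bilin U).
HB.instance Definition _ U := GRing.Linear.on (@runit U).

Lemma tmapE U U' V V' (f : {linear U -> U'}) (g : {linear V -> V'}) u v :
  tmap f g (pure u v) = pure (f u) (g v).
Proof. exact: tliftE. Qed.
Lemma tswapE U V (u : U) (v : V) : tswap (pure u v) = pure v u.
Proof. exact: tliftE. Qed.
Lemma tassocE U V W (u : U) (v : V) (w : W) :
  tassoc (pure (pure u v) w) = pure u (pure v w).
Proof. by rewrite /tassoc !tliftE. Qed.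
Lemma tassocVE U V W (u : U) (v : V) (w : W) :
  tassocV (pure u (pure v w)) = pure (pure u v) w.
Proof. by rewrite /tassocV !tliftE. Qed.
Lemma lunitE U (a : k^o) (u : U) : lunit (pure a u) = a *: u.
Proof. exact: tliftE. Qed.
Lemma runitE U (u : U) (a : k^o) : runit (pure u a) = a *: u.
Proof. exact: tliftE. Qed.

Lemma tassocK U V W : cancel (@tassoc U V W) (@tassocV U V W).
Proof.
apply: (tensor_linear_ext (f := @tassocV U V W \o @tassoc U V W) (g := idfun)) => y w.
have [t ->] := pureP y; rewrite !pure_suml !linear_sum.
by apply: eq_bigr => uv _; rewrite /= tassocE tassocVE.
Qed.
Lemma tassocVK U V W : cancel (@tassocV U V W) (@tassoc U V W).
Proof.
apply: (tensor_linear_ext (f := @tassoc U V W \o @tassocV U V W) (g := idfun)) => u y.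
have [t ->] := pureP y; rewrite !pure_sumr !linear_sum.
by apply: eq_bigr => vw _; rewrite /= tassocVE tassocE.
Qed.

End TensorMaps.

Section DirectSum.
Context {k : comPzRingType} {I : choiceType} (M : I -> lmodType k).

Record dsum := DSum {
  dsum_fun :> forall i, M i;
  dsum_fin : finite_set [set i | dsum_fun i != 0]%classic }.

HB.instance Definition _ := gen_eqMixin dsum.
HB.instance Definition _ := gen_choiceMixin dsum.

Lemma dsumP (x y : dsum) : (forall i, x i = y i) -> x = y.
Proof.
case: x y => [f hf] [g hg] /= h; have e : f = g by apply: functional_extensionality_dep.
by case: _ / e hg => hg; congr DSum; apply: Prop_irrelevance.
Qed.

Lemma dsum_fin_sub (f : forall i, M i) (x y : dsum) :
  (forall i, x i = 0 -> y i = 0 -> f i = 0) -> finite_set [set i | f i != 0]%classic.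
Proof.
move=> h; have /sub_finite_set : ([set i | f i != 0] `<=`
  [set i | x i != 0] `|` [set i | y i != 0])%classic.
  move=> i /= fi; have [xi|] := eqVneq (x i) 0; last by left.
  by right; apply: contra_neq fi; apply: h.
by apply; rewrite finite_setU; split; apply: dsum_fin.
Qed.

Fact dsum0_fin : finite_set [set i | (0 : M i) != 0]%classic.
Proof.
suff -> : [set i | (0 : M i) != 0]%classic = set0 by exact: finite_set0.
by apply/seteqP; split=> i //=; rewrite eqxx.
Qed.
Definition dsum0 := DSum dsum0_fin.
Fact dsumD_fin (x y : dsum) : finite_set [set i | x i + y i != 0]%classic.
Proof. by apply: (@dsum_fin_sub _ x y) => i -> ->; rewrite addr0. Qed.
Definition dsumD x y := DSum (dsumD_fin x y).
Fact dsumN_fin (x : dsum) : finite_set [set i | - x i != 0]%classic.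
Proof. by apply: (@dsum_fin_sub _ x x) => i ->; rewrite oppr0. Qed.
Definition dsumN x := DSum (dsumN_fin x).
Fact dsumZ_fin a (x : dsum) : finite_set [set i | a *: x i != 0]%classic.
Proof. by apply: (@dsum_fin_sub _ x x) => i ->; rewrite scaler0. Qed.
Definition dsumZ a x := DSum (dsumZ_fin a x).

Fact dsumDA : associative dsumD.
Proof. by move=> x y z; apply: dsumP => i /=; rewrite addrA. Qed.
Fact dsumDC : commutative dsumD.
Proof. by move=> x y; apply: dsumP => i /=; rewrite addrC. Qed.
Fact dsum0D : left_id dsum0 dsumD.
Proof. by move=> x; apply: dsumP => i /=; rewrite add0r. Qed.
Fact dsumND : left_inverse dsum0 dsumN dsumD.
Proof. by move=> x; apply: dsumP => i /=; rewrite addNr. Qed.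
HB.instance Definition _ := GRing.isZmodule.Build dsum dsumDA dsumDC dsum0D dsumND.

Fact dsumZA a b x : dsumZ a (dsumZ b x) = dsumZ (a * b) x.
Proof. by apply: dsumP => i /=; rewrite scalerA. Qed.
Fact dsum1Z : left_id 1 dsumZ.
Proof. by move=> x; apply: dsumP => i /=; rewrite scale1r. Qed.
Fact dsumZDr : right_distributive dsumZ +%R.
Proof. by move=> a x y; apply: dsumP => i /=; rewrite scalerDr. Qed.
Fact dsumZDl x : {morph dsumZ^~ x : a b / a + b}.
Proof. by move=> a b; apply: dsumP => i /=; rewrite scalerDl. Qed.
HB.instance Definition _ := GRing.Zmodule_isLmodule.Build k dsum
  dsumZA dsum1Z dsumZDr dsumZDl.

Fact dinj_fin i (x : M i) :
  finite_set [set j | dfwith (fun j => 0 : M j) x j != 0]%classic.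
Proof.
apply: (@sub_finite_set _ _ [set i]%classic); last exact: finite_set1.
by move=> j /=; case: dfwithP => // j' _; rewrite eqxx.
Qed.
Definition dinj i (x : M i) := DSum (dinj_fin x).

Fact dinj_linear i : linear (@dinj i).
Proof.
move=> a x y; apply: dsumP => j /=.
have [<-|ne] := eqVneq i j; first by rewrite !dfwith_in.
by rewrite !dfwith_out // scaler0 addr0.
Qed.
HB.instance Definition _ i :=
  GRing.isLinear.Build k (M i) dsum *:%R (@dinj i) (@dinj_linear i).

Lemma dsum_supp (s : seq dsum) : exists2 r : seq I,
  uniq r & forall x, x \in s -> forall i, i \notin r -> x i = 0.
Proof.
elim: s => [|x s [r ur hr]]; first by exists [::].
have /finite_seqP [r' hr'] := dsum_fin x.
exists (undup (r' ++ r)) => [|y]; first exact: undup_uniq.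
rewrite inE => /orP[/eqP->|ys] i; rewrite mem_undup mem_cat negb_or => /andP[h1 h2].
  apply/eqP; apply: contraNT h1 => h1.
  by have : [set i | x i != 0]%classic i by []; rewrite hr'.
exact: hr.
Qed.

Lemma fsum_seq (W : nmodType) (f : I -> W) (r : seq I) : uniq r ->
  (forall i, i \notin r -> f i = 0) -> \sum_(i \in [set: I]) f i = \sum_(i <- r) f i.
Proof.
move=> ur hr; rewrite (fsbigE r) //= => [|i _]; last exact: hr.
by apply: eq_bigl => i; rewrite in_setT.
Qed.

Section Lift.
Context {W : lmodType k} (F : forall i, {linear M i -> W}).

Definition dlift (x : dsum) : W := \sum_(i \in [set: I]) F i (x i).

Fact dlift_linear : linear dlift.
Proof.
move=> a x y; have [r ur hr] := dsum_supp [:: x; y; a *: x + y].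
have h z : z \in [:: x; y; a *: x + y] -> dlift z = \sum_(i <- r) F i (z i).
  by move=> zs; apply: fsum_seq => // i ir; rewrite (hr z) ?linear0.
rewrite !h ?inE ?eqxx ?orbT // scaler_sumr -big_split /=.
by apply: eq_bigr => i _; rewrite -linearP.
Qed.
HB.instance Definition _ := GRing.isLinear.Build k dsum W *:%R dlift dlift_linear.

Lemma dlift_inj i (x : M i) : dlift (dinj x) = F i x.
Proof.
rewrite /dlift (@fsum_seq _ _ [:: i]) // => [|j].
  by rewrite big_seq1 /= dfwith_in.
by rewrite inE eq_sym => ij; rewrite /= dfwith_out // linear0.
Qed.
End Lift.

Lemma dinjP (x : dsum) : exists s : seq {i & M i},
  x = \sum_(t <- s) dinj (tagged t).
Proof.
have [r ur hr] := dsum_supp [:: x].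
exists [seq Tagged M (x i) | i <- r]; rewrite big_map.
apply: dsumP => j.
pose ev := fun z : dsum => z j.
rewrite -[RHS]/(ev _) (@big_morph _ _ ev 0 +%R) //.
have [jr|jr] := boolP (j \in r); last first.
  rewrite (hr x) ?inE // big_seq big1 // => i ir; rewrite /ev /= dfwith_out //.
  by apply: contraNneq jr => <-.
rewrite (bigD1_seq j) //= /ev dfwith_in big1 ?addr0 // => i ij.
by rewrite /= dfwith_out.
Qed.

Lemma dsum_linear_ext (W : lmodType k) (f g : {linear dsum -> W}) :
  (forall i (x : M i), f (dinj x) = g (dinj x)) -> f =1 g.
Proof.
move=> h x; have [s ->] := dinjP x; rewrite !linear_sum.
by apply: eq_bigr => t _; apply: h.
Qed.

Definition sgn (m : int) : k := (-1) ^+ `|m|%N.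

Section SignedFlip.
Variable e : I -> I -> int.

Definition flip_fun (x y : dsum) : tensor dsum dsum :=
  \sum_(i \in [set: I]) \sum_(j \in [set: I])
     sgn (e i j) *: pure (dinj (y j)) (dinj (x i)).

Lemma flip_fun_bilin : bilin flip_fun.
Proof.
have E (x y : dsum) r : uniq r -> (forall i, i \notin r -> x i = 0) ->
    (forall i, i \notin r -> y i = 0) -> flip_fun x y =
    \sum_(i <- r) \sum_(j <- r) sgn (e i j) *: pure (dinj (y j)) (dinj (x i)).
  move=> ur hx hy.
  have E1 i : \sum_(j \in [set: I]) sgn (e i j) *: pure (dinj (y j)) (dinj (x i))
      = \sum_(j <- r) sgn (e i j) *: pure (dinj (y j)) (dinj (x i)).
    by apply: fsum_seq => // j jr; rewrite hy // linear0 pure0l scaler0.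
  rewrite /flip_fun (@fsum_seq _ _ r) // => [|i ir]; first exact: eq_bigr.
  by rewrite E1 big1 // => j _; rewrite hx // linear0 pure0r scaler0.
split=> [y|y] a x z; have [r ur hr] := dsum_supp [:: x; y; z; a *: x + z];
  rewrite !(E _ _ r) //; try by apply: hr; rewrite !inE eqxx ?orbT.
all: rewrite scaler_sumr -big_split; apply: eq_bigr => i _ /=.
all: rewrite scaler_sumr -big_split; apply: eq_bigr => j _ /=.
all: by rewrite linearP ?(pureDl, pureDr) ?(pureZl, pureZr) scalerDr !scalerA
  [a * _]mulrC.
Qed.

(* The flip a ⊗ b ↦ (-1)^(e i j) b ⊗ a for a in M i and b in M j. *)
Definition signed_flip := tlift flip_fun_bilin.
HB.instance Definition _ := GRing.Linear.on signed_flip.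

Lemma signed_flipE i j (a : M i) (b : M j) :
  signed_flip (pure (dinj a) (dinj b)) = sgn (e i j) *: pure (dinj b) (dinj a).
Proof.
rewrite /signed_flip tliftE /flip_fun (@fsum_seq _ _ [:: i]) // => [|i']; last first.
  rewrite inE eq_sym => ii; rewrite (@fsum_seq _ _ [::]) ?big_nil // => j' _.
  by rewrite [dinj a i']dfwith_out // linear0 pure0r scaler0.
rewrite big_seq1 (@fsum_seq _ _ [:: j]) // => [|j'].
  by rewrite big_seq1 /= !dfwith_in.
by rewrite inE eq_sym => jj; rewrite [dinj b j']dfwith_out // linear0 pure0l scaler0.
Qed.
End SignedFlip.

End DirectSum.

Arguments dinj {k I M i} x.

(* A graded module is a family M : I -> lmodType k whose piece M i has degree
   deg i, so that its part of degree m is the sum of the M i with deg i = m;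
   as a module it is the direct sum of the pieces. *)
Section DGLieCoalgebra.
Context {k : comPzRingType} {I : choiceType} (deg : I -> int) (M : I -> lmodType k).
Local Notation L := (dsum M).

Definition homogeneous (m : int) (x : L) : Prop :=
  forall i, x i != 0 -> deg i = m.

Definition tensor_homogeneous (m : int) (t : tensor L L) : Prop :=
  exists2 s : seq (L * L), t = \sum_(xy <- s) pure xy.1 xy.2 &
    forall xy, xy \in s ->
      exists2 a : int, homogeneous a xy.1 & homogeneous (m - a) xy.2.

Definition graded_flip : tensor L L -> tensor L L :=
  signed_flip (fun i j => deg i * deg j).
HB.instance Definition _ := GRing.Linear.on graded_flip.

Definition flip12 : tensor (tensor L L) L -> tensor (tensor L L) L :=
  tmap graded_flip idfun.
HB.instance Definition _ := GRing.Linear.on flip12.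

Definition flip23 : tensor (tensor L L) L -> tensor (tensor L L) L :=
  @tassocV _ L L L \o tmap idfun graded_flip \o @tassoc _ L L L.
HB.instance Definition _ := GRing.Linear.on flip23.

Record dg_Lie_coalgebra (d : {linear L -> L}) (c : {linear L -> tensor L L}) :
    Prop := DGLieCoalgebra {
  dg_diff_degree : forall m x, homogeneous m x -> homogeneous (m - 1) (d x);
  dg_diff_square : forall x, d (d x) = 0;
  dg_cobracket_degree : forall m x, homogeneous m x -> tensor_homogeneous m (c x);
  dg_coderivation : forall x, c (d x) =
    tmap d idfun (c x) + graded_flip (tmap d idfun (graded_flip (c x)));
  dg_coantisymmetry : forall x, exists t, c x = t - graded_flip t;
  dg_coJacobi : forall x, let y := tmap c idfun (c x) in
    y + flip23 (flip12 y) + flip12 (flip23 y) = 0 }.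

End DGLieCoalgebra.

Arguments dg_Lie_coalgebra {k I} deg M d c.

(* cocomp n p q i is Δ_{p,q,i} : C(n) -> C(p) ⊗ C(q), which is meaningful only
   for n = p + q - 1 and 1 <= i <= p; keeping n as an index of its own avoids
   casts between the propositionally equal arities in the coassociativity laws.
   All other indices, including p = 0, give the zero map. *)
Record planar_cooperad (k : comPzRingType) := PlanarCooperad {
  coop :> nat -> lmodType k;
  counit : {linear coop 1 -> k^o};
  cocomp : forall n p q i : nat, {linear coop n -> tensor (coop p) (coop q)};
  cocomp_out : forall n p q i x,
    ~~ ((n.+1 == p + q) && (0 < i <= p))%N -> cocomp n p q i x = 0;
  counit_left : forall n x, lunit (tmap counit idfun (cocomp n 1 n 1 x)) = x;
  counit_right : forall n i x, (0 < i <= n)%N ->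
    runit (tmap idfun counit (cocomp n n 1 i x)) = x;
  coassoc_right : forall p q r i j x, (0 < i <= p)%N -> (i + q <= j < p + q)%N ->
    tassoc (tmap (cocomp (p + q).-1 p q i) idfun
      (cocomp (p + q + r).-2 (p + q).-1 r j x)) =
    tmap idfun (@tswap _ (coop r) (coop q))
      (tassoc (tmap (cocomp (p + r).-1 p r (j - q).+1) idfun
        (cocomp (p + q + r).-2 (p + r).-1 q i x)));
  coassoc_inner : forall p q r i j x, (0 < i <= p)%N -> (i <= j < i + q)%N ->
    tassoc (tmap (cocomp (p + q).-1 p q i) idfun
      (cocomp (p + q + r).-2 (p + q).-1 r j x)) =
    tmap idfun (cocomp (q + r).-1 q r (j - i).+1)
      (cocomp (p + q + r).-2 p (q + r).-1 i x);
  coassoc_left : forall p q r i j x, (0 < j < i)%N -> (i <= p)%N ->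
    tassoc (tmap (cocomp (p + q).-1 p q i) idfun
      (cocomp (p + q + r).-2 (p + q).-1 r j x)) =
    tmap idfun (@tswap _ (coop r) (coop q))
      (tassoc (tmap (cocomp (p + r).-1 p r j) idfun
        (cocomp (p + q + r).-2 (p + r).-1 q (i + r).-1 x))) }.

Record cooperad_with_comult (k : comPzRingType) := CooperadWithComult {
  cwc_coop :> planar_cooperad k;
  comult : {linear cwc_coop 2 -> k^o};
  coaug : {linear cwc_coop 0 -> k^o};
  comult_coassoc : forall x : cwc_coop 3,
    lunit (tmap comult comult (cocomp cwc_coop 3 2 2 1 x)) =
    lunit (tmap comult comult (cocomp cwc_coop 3 2 2 2 x));
  comult_coaug1 : forall x : cwc_coop 1,
    lunit (tmap comult coaug (cocomp cwc_coop 1 2 0 1 x)) = counit cwc_coop x;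
  comult_coaug2 : forall x : cwc_coop 1,
    lunit (tmap comult coaug (cocomp cwc_coop 1 2 0 2 x)) = counit cwc_coop x }.

Section Structure.
Context {k : comPzRingType} (C : cooperad_with_comult k).
Local Notation T := (dsum C).

Definition diff_comp (n : nat) (x : C n) : C n.-1 :=
  if n == 0 then 0 else
  lunit (tmap (comult C) idfun
    (cocomp C n 2 n.-1 2 x + (-1) ^+ n *: cocomp C n 2 n.-1 1 x))
  + \sum_(1 <= i < n) (-1) ^+ i *:
      runit (tmap idfun (comult C) (cocomp C n n.-1 2 i x)).

Fact diff_comp_linear n : linear (@diff_comp n).
Proof.
move=> a x y; rewrite /diff_comp; case: eqP => _; first by rewrite scaler0 addr0.
rewrite scalerDr addrACA; congr (_ + _).
  rewrite -linearP -linearP; congr (lunit (tmap _ _ _)).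
  rewrite (linearP (cocomp C n 2 n.-1 2)) (linearP (cocomp C n 2 n.-1 1)).
  by rewrite !scalerDr !scalerA [_ * a]mulrC addrACA.
rewrite scaler_sumr -big_split; apply: eq_bigr => i _ /=.
by rewrite (linearP (cocomp _ _ _ _ _)) (linearP (tmap _ _)) (linearP (@runit _ _)) scalerDr
  !scalerA mulrC.
Qed.
HB.instance Definition _ n :=
  GRing.isLinear.Build k (C n) (C n.-1) *:%R (@diff_comp n) (@diff_comp_linear n).

Definition differential : T -> T :=
  dlift (fun n => (dinj \o @diff_comp n : {linear C n -> T})).
HB.instance Definition _ := GRing.Linear.on differential.

(* The exponent (n - p)(p - i) is an integer: n - p = -1 when p = n + 1. *)
Definition cobrace_comp (n : nat) (x : C n) : tensor T T :=
  \sum_(1 <= p < n.+2) \sum_(1 <= i < p.+1)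
    sgn ((n%:Z - p%:Z) * (p%:Z - i%:Z)) *:
      tmap dinj dinj (cocomp C n p (n.+1 - p) i x).

Fact cobrace_comp_linear n : linear (@cobrace_comp n).
Proof.
move=> a x y; rewrite /cobrace_comp.
do 2![rewrite scaler_sumr -big_split; apply: eq_bigr => ? _ /=].
by rewrite (linearP (cocomp _ _ _ _ _)) (linearP (tmap _ _)) scalerDr !scalerA mulrC.
Qed.
HB.instance Definition _ n :=
  GRing.isLinear.Build k (C n) (tensor T T) *:%R (@cobrace_comp n) (@cobrace_comp_linear n).

Definition cobrace : T -> tensor T T := dlift (fun n => @cobrace_comp n).
HB.instance Definition _ := GRing.Linear.on cobrace.

Definition rho : tensor T T -> tensor T T :=
  signed_flip (fun p q : nat => (p%:Z - 1) * (q%:Z - 1)).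
HB.instance Definition _ := GRing.Linear.on rho.

Definition cobracket (x : T) : tensor T T := cobrace x - rho (cobrace x).
Fact cobracket_linear : linear cobracket.
Proof. by move=> a x y; rewrite /cobracket (linearP cobrace) (linearP rho) scalerBr opprD addrACA. Qed.
HB.instance Definition _ :=
  GRing.isLinear.Build k T (tensor T T) *:%R cobracket cobracket_linear.

End Structure.

Arguments differential {k} C x.
Arguments cobrace {k} C x.
Arguments rho {k} C x.
Arguments cobracket {k} C x.

(* Main.v *)
(* Write b for the cobrace, c = (1 - tau) b for the cobracket, and let s and t be
   the graded flips of the first two and of the last two factors of a triple
   tensor product, so that s and t satisfy the relations of S_3.  Put
   X = (b ⊗ 1) b and Y = (1 ⊗ b) b.  Coassociativity cancels the nested
   summands of X against those of Y, and t exchanges the summands with parallel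
   insertions, so X - Y = A + t A for some A: the cobrace is a graded pre-Lie
   cobracket, even over a ring in which 2 is a zero divisor.  Moreover
   d = (mu ⊗ 1) c, where mu extends the comultiplication C(2) -> k by zero.
   The co-Jacobi identity, the coderivation property and d^2 = 0 then follow by
   computing with words in s and t applied to X and Y; for d^2 = 0 one also uses
   (mu ⊗ mu) b = 0, which is the coassociativity of mu. *)
Require Import Defs.
From HB Require Import structures.
From mathcomp Require Import all_boot all_order all_algebra.
From mathcomp Require Import zify ring.
Import GRing.Theory.
Local Open Scope ring_scope.

Set Implicit Arguments.
Unset Strict Implicit.
Unset Printing Implicit Defensive.

(** * Signs with an integer exponent *)

Section Sign.
Context {k : comPzRingType}.
Local Notation sgn := (@sgn k).

Lemma sgnD m n : sgn (m + n) = sgn m * sgn n.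
Proof.
rewrite /Defs.sgn -exprD -signr_odd -[RHS]signr_odd; congr (_ ^+ nat_of_bool _).
lia.
Qed.

Lemma sgn_sq m : sgn m * sgn m = 1.
Proof. by rewrite /Defs.sgn -exprD addnn -signr_odd odd_double. Qed.

Lemma sgn_double m : sgn (m + m) = 1.
Proof. by rewrite sgnD sgn_sq. Qed.

Lemma sgnE m n : odd `|m| = odd n -> sgn m = (-1) ^+ n.
Proof. by rewrite /Defs.sgn -signr_odd => ->; rewrite signr_odd. Qed.

End Sign.

(** * Induction and functoriality for tensor products *)

Section TensorFacts.
Context {k : comPzRingType}.
Implicit Types U V W : lmodType k.

Lemma tensor_ind U V (P : tensor U V -> Prop) :
  P 0 -> (forall u v x, P x -> P (pure u v + x)) -> forall x, P x.
Proof.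
move=> P0 PD x; have [s ->] := pureP x.
by elim: s => [|uv s IH]; rewrite ?big_nil ?big_cons //; apply: PD.
Qed.

Lemma pureBl U V (u u' : U) (v : V) : pure (u - u') v = pure u v - pure u' v.
Proof. by rewrite -scaleN1r pureDl pureZl scaleN1r. Qed.

Lemma pureBr U V (u : U) (v v' : V) : pure u (v - v') = pure u v - pure u v'.
Proof. by rewrite -scaleN1r pureDr pureZr scaleN1r. Qed.

Lemma pure_suml_cond U V (I : Type) (r : seq I) (P : pred I) (f : I -> U) (v : V) :
  pure (\sum_(i <- r | P i) f i) v = \sum_(i <- r | P i) pure (f i) v.
Proof. exact: (big_morph (pure^~ v) (pureDl v) (pure0l v)). Qed.

Lemma pure_sumr_cond U V (I : Type) (r : seq I) (P : pred I) (u : U) (f : I -> V) :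
  pure u (\sum_(i <- r | P i) f i) = \sum_(i <- r | P i) pure u (f i).
Proof. exact: (big_morph (pure u) (pureDr u) (pure0r u)). Qed.

Lemma tmap_comp U U' U'' V V' V'' (f : {linear U -> U'}) (f' : {linear U' -> U''})
    (g : {linear V -> V'}) (g' : {linear V' -> V''}) x :
  tmap f' g' (tmap f g x) = tmap (f' \o f) (g' \o g) x.
Proof.
elim/tensor_ind: x => [|u v x IH]; first by rewrite !linear0.
by rewrite !linearD /= IH !tmapE.
Qed.

Lemma tmap0l U U' V V' (f : {linear U -> U'}) (g : {linear V -> V'}) x :
  (forall u, f u = 0) -> tmap f g x = 0.
Proof.
move=> f0; elim/tensor_ind: x => [|u v x IH]; first exact: linear0.
by rewrite linearD /= IH addr0 tmapE f0 pure0l.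
Qed.

Lemma tmap0r U U' V V' (f : {linear U -> U'}) (g : {linear V -> V'}) x :
  (forall v, g v = 0) -> tmap f g x = 0.
Proof.
move=> g0; elim/tensor_ind: x => [|u v x IH]; first exact: linear0.
by rewrite linearD /= IH addr0 tmapE g0 pure0r.
Qed.

End TensorFacts.

(** * Graded flips on tensor powers of a direct sum, and the relations of S_3 *)

Section DirectSumFacts.
Context {k : comPzRingType} {I : choiceType} {M : I -> lmodType k}.
Local Notation L := (dsum M).

Lemma dsum_ind (P : L -> Prop) :
  P 0 -> (forall i (a : M i) x, P x -> P (dinj a + x)) -> forall x, P x.
Proof.
move=> P0 PD x; have [s ->] := dinjP x.
by elim: s => [|[i a] s IH]; rewrite ?big_nil ?big_cons //; apply: PD.
Qed.

Lemma tensor_dsum_ext (W : lmodType k) (f g : {linear tensor L L -> W}) :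
  (forall i j (a : M i) (b : M j),
    f (pure (dinj a) (dinj b)) = g (pure (dinj a) (dinj b))) -> f =1 g.
Proof.
move=> fg; apply: tensor_linear_ext => u v.
elim/dsum_ind: u => [|i a u IHu]; first by rewrite pure0l !linear0.
rewrite pureDl !linearD {}IHu; congr (_ + _).
elim/dsum_ind: v => [|j b v IHv]; first by rewrite pure0r !linear0.
by rewrite pureDr !linearD IHv fg.
Qed.

Lemma tensor3_dsum_ext (W : lmodType k) (f g : {linear tensor (tensor L L) L -> W}) :
  (forall i j l (a : M i) (b : M j) (c : M l),
    f (pure (pure (dinj a) (dinj b)) (dinj c)) =
    g (pure (pure (dinj a) (dinj b)) (dinj c))) -> f =1 g.
Proof.
move=> fg; apply: tensor_linear_ext => z w.
elim/(@tensor_ind k): z => [|u v z IHz]; first by rewrite pure0l !linear0.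
rewrite pureDl !linearD {}IHz; congr (_ + _).
elim/dsum_ind: w => [|l c w IHw]; first by rewrite pure0r !linear0.
rewrite pureDr !linearD {}IHw; congr (_ + _).
elim/dsum_ind: u => [|i a u IHu]; first by rewrite pure0l pure0l !linear0.
rewrite !pureDl !linearD {}IHu; congr (_ + _).
elim/dsum_ind: v => [|j b v IHv]; first by rewrite pure0r pure0l !linear0.
by rewrite pureDr pureDl !linearD IHv fg.
Qed.

Variable deg : I -> int.
Local Notation tau := (graded_flip deg (M := M)).
Local Notation s := (flip12 deg (M := M)).
Local Notation t := (flip23 deg (M := M)).

Lemma graded_flipE i j (a : M i) (b : M j) :
  tau (pure (dinj a) (dinj b)) = sgn (deg i * deg j) *: pure (dinj b) (dinj a).
Proof. exact: signed_flipE. Qed.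

Lemma flip12E i j (a : M i) (b : M j) (c : L) :
  s (pure (pure (dinj a) (dinj b)) c) =
  sgn (deg i * deg j) *: pure (pure (dinj b) (dinj a)) c.
Proof. by rewrite /flip12 tmapE /= graded_flipE pureZl. Qed.

Lemma flip23E i j (c : L) (a : M i) (b : M j) :
  t (pure (pure c (dinj a)) (dinj b)) =
  sgn (deg i * deg j) *: pure (pure c (dinj b)) (dinj a).
Proof.
by rewrite /flip23 /= tassocE tmapE /= graded_flipE pureZr linearZ /= tassocVE.
Qed.

Lemma graded_flipK : involutive tau.
Proof.
apply: (tensor_dsum_ext (f := tau \o tau) (g := idfun)) => i j a b /=.
rewrite graded_flipE linearZ /= graded_flipE scalerA.
by rewrite [deg j * _]mulrC sgn_sq scale1r.
Qed.

Lemma flip12K : involutive s.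
Proof.
move=> x; rewrite /flip12 tmap_comp.
elim/(@tensor_ind k): x => [|u v x IH]; first by rewrite linear0.
by rewrite linearD /= {}IH tmapE /= graded_flipK.
Qed.

Lemma flip23K : involutive t.
Proof.
move=> x; rewrite /flip23 /= tassocVK tmap_comp -[RHS]tassocK; congr (tassocV _).
elim/(@tensor_ind k): (tassoc x) => [|u v y IH]; first by rewrite linear0.
by rewrite linearD /= {}IH tmapE /= graded_flipK.
Qed.

(** Both sides reverse the three factors, and both signs are the product of the same three pairwise
    signs. *)
Lemma flip_braid x : s (t (s x)) = t (s (t x)).
Proof.
move: x; apply: (tensor3_dsum_ext (f := s \o (t \o s)) (g := t \o (s \o t))).
move=> i j l a b c /=.
rewrite flip12E flip23E !linearZ /= flip12E flip23E !linearZ /= flip12E flip23E.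
rewrite !scalerA; congr (_ *: _).
exact: mulrAC.
Qed.

End DirectSumFacts.

(** Moves [a] and then [- a] to the end of a left-nested sum and cancels the pair. *)
Ltac cancel_term a :=
  repeat rewrite (addrAC _ a); repeat rewrite (addrAC _ (- a)); rewrite (addrK a).

(** * Pre-Lie identities as word computations in a module over S_3 *)

Section SymmetricGroupModule.
Context {k : comPzRingType} {V : lmodType k} (s t : {linear V -> V}).
Hypotheses (sK : involutive s) (tK : involutive t).
Hypothesis (st_braid : forall x, s (t (s x)) = t (s (t x))).
Context {X Y : V} (tXY : t (X - Y) = X - Y).

(** With the involutions and the braid relation, this rule brings every word to a combination of
    nine terms: X, s X, t s X and the six words in Y. In the next two lemmas these cancel one by
    one. *)
Let tX : t X = t Y + (X - Y).
Proof. by rewrite -tXY linearB addrC subrK. Qed.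

Let stE := (linearB s, linearD s, linearN s, linearB t, linearD t, linearN t, tX).

(** For the iterated cobraces X and Y, [y] is (c ⊗ 1) c, and the sum runs over its cyclic
    permutations. *)
Lemma pre_Lie_Jacobi (u := X - t (s Y)) (y := u - s u) : y + t (s y) + s (t y) = 0.
Proof.
rewrite /y /u; do 3!rewrite ?stE ?(sK, tK, st_braid).
(* The leading zero gives the first summand a left neighbour, so that [cancel_term] can move it
   too. *)
rewrite -[LHS]add0r !(opprB, opprD, opprK) !addrA.
cancel_term X; cancel_term Y; cancel_term (s X); cancel_term (s Y); cancel_term (t Y).
cancel_term (s (t Y)); cancel_term (t (s X)); cancel_term (t (s Y)).
by cancel_term (t (s (t Y))).
Qed.

(** For the iterated cobraces this reads (1 ⊗ c) c = (c ⊗ 1) c - t (c ⊗ 1) c; contracting the first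
    factor with mu turns it into the coderivation property. *)
Lemma pre_Lie_coderivation :
  Y - s (t X) - t (Y - s (t X)) =
  X - t (s Y) - s (X - t (s Y)) - t (X - t (s Y) - s (X - t (s Y))).
Proof.
apply/eqP; rewrite -subr_eq0; apply/eqP.
do 3!rewrite ?stE ?(sK, tK, st_braid).
rewrite -[LHS]add0r !(opprB, opprD, opprK) !addrA.
cancel_term X; cancel_term Y; cancel_term (s X); cancel_term (s Y); cancel_term (t Y).
cancel_term (s (t Y)); cancel_term (t (s X)); cancel_term (t (s Y)).
by cancel_term (t (s (t Y))).
Qed.
(** The role of [e] is that of mu ⊗ mu ⊗ 1. From t s (X - Y) = t s A + s t s A and e s = - e one
    gets e (t s X) = e (t s Y). Invariance of X - Y under t alone would only give this up to a
    factor 2, hence the decomposition through A. *)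
Lemma pre_Lie_square (W : lmodType k) (e : {linear V -> W}) (A : V) :
    (forall x, e (s x) = - e x) -> X - Y = A + t A -> e X = 0 -> e (t (s Y)) = 0 ->
  e (Y - s (t X) - t (Y - s (t X))) = 0.
Proof.
move=> es XY eX etsY.
have etsX : e (t (s X)) = 0.
  rewrite -[X in e (t (s X))](subrK Y) XY !stE !(linearD e) /= etsY addr0.
  by rewrite -st_braid es addrN.
rewrite !stE -st_braid !(linearB e, linearD e) /= !es etsX etsY eX.
rewrite !(oppr0, opprK, add0r, subr0, addr0) opprD opprK.
by rewrite [e Y + _]addrC subrK addrN.
Qed.

End SymmetricGroupModule.

(** * Reindexing of sums over arities and insertion positions *)

Section Sums.
Context {V : nmodType}.

(** The intermediate arity P is p + q - 1, so its sum collapses. Vanishing at p = 0 covers p = q =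
    0, where the predecessor truncates. *)
Lemma sum_nested_compositions n N (H : nat -> nat -> nat -> nat -> V) :
    (n.+2 < N)%N -> (forall P r q, H P r 0 q = 0) ->
  \sum_(P < N) \sum_(r < N | (P + r == n.+1)%N) \sum_(p < N) \sum_(q < N | (p + q == P.+1)%N)
     H P r p q =
  \sum_(p < N) \sum_(q < N) \sum_(r < N | (p + q + r == n.+2)%N) H (p + q).-1 r p q.
Proof.
move=> nN H0.
under eq_bigr do under eq_bigr do (under eq_bigr do rewrite big_mkcond).
under eq_bigr do rewrite exchange_big.
rewrite exchange_big; apply: eq_bigr => -[p pN] _ /=.
under eq_bigr do rewrite exchange_big.
rewrite exchange_big; apply: eq_bigr => -[q qN] _ /=.
under eq_bigr do rewrite big_mkcond.
rewrite exchange_big [RHS]big_mkcond; apply: eq_bigr => -[r rN] _ /=.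
have [p0|p0] := posnP p.
  rewrite p0; under eq_bigr do rewrite H0 !if_same.
  by rewrite H0 if_same big1.
have [e|ne] := eqVneq.
  have mN : ((p + q).-1 < N)%N by lia.
  rewrite (bigD1 (Ordinal mN)) //= big1 => [|i]; last first.
    rewrite -val_eqE /= => ne; case: eqP => // _; case: eqP => // pq.
    by move: ne; rewrite pq eqxx.
  by rewrite addr0 !ifT //; apply/eqP; lia.
by rewrite big1 // => i _; case: eqP => // ir; case: eqP => // pq; lia.
Qed.

Lemma sum_triangle p (f : nat -> nat -> V) :
  \sum_(1 <= i < p.+1) \sum_(i.+1 <= a < p.+1) f i a =
  \sum_(1 <= a < p.+1) \sum_(1 <= i < a) f i a.
Proof.
under eq_big_nat => i Hi.
  rewrite (@big_nat_widenl _ _ _ _ 1); last by [].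
over.
under [RHS]eq_big_nat => i Hi.
  rewrite (@big_nat_widen _ _ _ _ _ p.+1); last by lia.
over.
rewrite (exchange_big_dep_nat xpredT) //=.
Qed.

(** The second position j lies before i, among the q inputs that replace i (j = l + i - 1), or after
    them (j = a + q - 1 with i < a): the three cases of coassociativity. *)
Lemma sum_split_insertions p q (f : nat -> nat -> V) :
  \sum_(1 <= i < p.+1) \sum_(1 <= j < (p + q)%N) f i j =
    \sum_(1 <= i < p.+1) \sum_(1 <= j < i) f i j
  + \sum_(1 <= i < p.+1) \sum_(1 <= l < q.+1) f i (l + i).-1
  + \sum_(1 <= a < p.+1) \sum_(1 <= i < a) f i (a + q).-1.
Proof.
rewrite -[X in _ = _ + X]sum_triangle -!big_split; apply: eq_big_nat => i /= /andP[i0 ip].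
rewrite (big_cat_nat (n := i)) //=; last by lia.
rewrite (big_cat_nat (m := i) (n := (i + q)%N)) //=; [|lia..].
rewrite addrA; congr (_ + _ + _).
  by rewrite -{1}[i]add0n big_addn addKn [RHS]big_add1.
by rewrite big_addn addnK [RHS]big_add1.
Qed.

Lemma sum_arity_at n N p0 q0 (f : nat -> nat -> V) :
    (n.+1 < N)%N -> (p0 + q0 = n.+1)%N ->
    (forall p q, (p + q = n.+1)%N -> p != p0 -> f p q = 0) ->
  \sum_(p < N) \sum_(q < N | (p + q == n.+1)%N) f p q = f p0 q0.
Proof.
move=> nN e f0; have pN : (p0 < N)%N by lia.
have qN : (q0 < N)%N by lia.
rewrite (bigD1 (Ordinal pN)) //= [X in _ + X]big1 ?addr0 => [|p]; last first.
  by rewrite -val_eqE /= => pp; apply: big1 => q /eqP pq; apply: f0.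
rewrite (big_pred1 (Ordinal qN)) // => q; rewrite /= -val_eqE /=; lia.
Qed.

End Sums.

(** * The iterated cobrace and its pre-Lie relation *)

Section Cobrace.
Context {k : comPzRingType} (C : cooperad_with_comult k).
Local Notation T := (dsum C).
Local Notation sgn := (@sgn k).
Local Notation deg := (fun n : nat => n%:Z - 1).
Local Notation tau := (graded_flip deg (M := C)).
Local Notation s := (flip12 deg (M := C)).
Local Notation t := (flip23 deg (M := C)).
Local Notation ins p q i := (sgn ((q%:Z - 1) * (p%:Z - i%:Z))).
Local Notation b := (cobrace C).

(** Under p + q = n + 1 the exponent (n - p)(p - i) is (q - 1)(p - i), so the sign no longer
    mentions n. Summing p and q below a common bound N lets iterates be reindexed over triples of
    arities. *)
Lemma cobrace_dinj n N (x : C n) : (n.+1 < N)%N ->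
  b (dinj x) = \sum_(p < N) \sum_(q < N | (p + q == n.+1)%N) \sum_(1 <= i < p.+1)
    ins p q i *: tmap dinj dinj (cocomp C n p q i x).
Proof.
move=> nN; rewrite [LHS]dlift_inj /= /cobrace_comp.
rewrite -(big_mkord xpredT (fun p => \sum_(q < N | (p + q == n.+1)%N)
  \sum_(1 <= i < p.+1) ins p q i *: tmap dinj dinj (cocomp C n p q i x))).
rewrite [RHS](big_cat_nat (n := 1)) /=; [|lia..].
rewrite [X in _ = _ + X](big_cat_nat (n := n.+2)) /=; [|lia..].
rewrite [X in _ = X + _]big1_seq ?add0r => [|p]; last first.
  rewrite mem_index_iota => /andP[_ p0]; have -> : p = 0%N by lia.
  by apply: big1 => q _; rewrite big_geq.
rewrite [X in _ = _ + X]big1_seq ?addr0 => [|p]; last first.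
  rewrite mem_index_iota => /andP[_ pn]; apply: big_pred0 => q; lia.
apply: eq_big_nat => p pn.
have qN : (n.+1 - p < N)%N by lia.
rewrite (big_pred1 (Ordinal qN)) => [|q]; last by rewrite /= -val_eqE /=; lia.
apply: eq_big_nat => i ip /=; congr (Defs.sgn _ *: _); congr (_ * _); lia.
Qed.

Lemma tmap_cobrace_l N P r (w : tensor (C P) (C r)) : (P.+1 < N)%N ->
  tmap b idfun (tmap dinj dinj w) =
  \sum_(p < N) \sum_(q < N | (p + q == P.+1)%N) \sum_(1 <= i < p.+1)
    ins p q i *: tmap (tmap dinj dinj) dinj (tmap (cocomp C P p q i) idfun w).
Proof.
move=> PN; elim/(@tensor_ind k): w => [|u v w IH].
  rewrite !linear0 big1 // => p _; rewrite big1 // => q _; rewrite big1 // => i _.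
  by rewrite !linear0.
rewrite !linearD /= {}IH !tmapE /= (cobrace_dinj u PN).
rewrite pure_suml_cond -big_split; apply: eq_bigr => p _.
rewrite pure_suml_cond -big_split; apply: eq_bigr => q _.
rewrite pure_suml_cond -big_split; apply: eq_bigr => i _.
by rewrite pureZl !linearD /= !tmapE.
Qed.

Lemma tmap_cobrace_r N p Q (w : tensor (C p) (C Q)) : (Q.+1 < N)%N ->
  tmap idfun b (tmap dinj dinj w) =
  \sum_(q < N) \sum_(r < N | (q + r == Q.+1)%N) \sum_(1 <= l < q.+1)
    ins q r l *: tmap dinj (tmap dinj dinj) (tmap idfun (cocomp C Q q r l) w).
Proof.
move=> QN; elim/(@tensor_ind k): w => [|u v w IH].
  rewrite !linear0 big1 // => q _; rewrite big1 // => r _; rewrite big1 // => i _.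
  by rewrite !linear0.
rewrite !linearD /= {}IH !tmapE /= (cobrace_dinj v QN).
rewrite pure_sumr_cond -big_split; apply: eq_bigr => q _.
rewrite pure_sumr_cond -big_split; apply: eq_bigr => r _.
rewrite pure_sumr_cond -big_split; apply: eq_bigr => i _.
by rewrite pureZr !linearD /= !tmapE.
Qed.

(** The arity P stays separate from p + q - 1, so that the term can be written under a sum over P
    without casts. *)
Definition left_term n P p q r i j (x : C n) : tensor (tensor T T) T :=
  tmap (tmap dinj dinj) dinj (tmap (cocomp C P p q i) idfun (cocomp C n P r j x)).

Definition right_term n Q p q r i l (x : C n) : tensor (tensor T T) T :=
  tassocV (tmap dinj (tmap dinj dinj)
    (tmap idfun (cocomp C Q q r l) (cocomp C n p Q i x))).

Lemma cobrace_left_iterate n N (x : C n) : (n.+2 < N)%N ->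
  tmap b idfun (b (dinj x)) =
  \sum_(p < N) \sum_(q < N) \sum_(r < N | (p + q + r == n.+2)%N)
    \sum_(1 <= i < p.+1) \sum_(1 <= j < (p + q)%N)
      (ins (p + q).-1 r j * ins p q i) *: left_term (p + q).-1 p q r i j x.
Proof.
move=> nN; pose H P r p q := \sum_(1 <= i < p.+1) \sum_(1 <= j < P.+1)
  (ins P r j * ins p q i) *: left_term P p q r i j x.
rewrite (cobrace_dinj x (ltnW nN)) linear_sum.
transitivity (\sum_(P < N) \sum_(r < N | (P + r == n.+1)%N)
    \sum_(p < N) \sum_(q < N | (p + q == P.+1)%N) H P r p q).
  apply: eq_bigr => P _; rewrite linear_sum; apply: eq_bigr => r /eqP Pr /=.
  have PN : (P.+1 < N)%N by lia.
  rewrite linear_sum /=.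
  under eq_bigr do rewrite linearZ /= (tmap_cobrace_l _ PN) scaler_sumr.
  rewrite exchange_big; apply: eq_bigr => p _.
  under eq_bigr do rewrite scaler_sumr.
  rewrite exchange_big; apply: eq_bigr => q _.
  under eq_bigr do rewrite scaler_sumr.
  rewrite exchange_big; apply: eq_bigr => i _; apply: eq_bigr => j _.
  by rewrite scalerA.
rewrite sum_nested_compositions // => [|P r q]; last by rewrite /H big_geq.
(* For positive [p] both sides agree by computation, as [(p + q).-1.+1] reduces to [p + q]; for
   [p = 0] the sums over i are empty. *)
apply: eq_bigr => -[[|p] pN] _; apply: eq_bigr => q _; apply: eq_bigr => r _ //.
by rewrite /H !big_geq.
Qed.

Lemma cobrace_right_iterate n N (x : C n) : (n.+2 < N)%N ->
  tassocV (tmap idfun b (b (dinj x))) =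
  \sum_(p < N) \sum_(q < N) \sum_(r < N | (p + q + r == n.+2)%N)
    \sum_(1 <= i < p.+1) \sum_(1 <= l < q.+1)
      (ins p (q + r).-1 i * ins q r l) *: right_term (q + r).-1 p q r i l x.
Proof.
move=> nN; pose H Q p q r := \sum_(1 <= l < q.+1) \sum_(1 <= i < p.+1)
  (ins p Q i * ins q r l) *: right_term Q p q r i l x.
have sum_r := linear_sum (tmap (@idfun T) b).
have sum_a := linear_sum (@tassocV k T T T).
rewrite (cobrace_dinj x (ltnW nN)) sum_r sum_a.
transitivity (\sum_(p < N) \sum_(Q < N | (Q + p == n.+1)%N)
    \sum_(q < N) \sum_(r < N | (q + r == Q.+1)%N) H Q p q r).
  apply: eq_bigr => p _; rewrite sum_r sum_a.
  apply: eq_big => [Q|Q /eqP pQ]; first by rewrite addnC.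
  have QN : (Q.+1 < N)%N by lia.
  rewrite sum_r sum_a.
  under eq_bigr do rewrite linearZ /= (tmap_cobrace_r _ QN) linearZ /= sum_a scaler_sumr.
  rewrite exchange_big; apply: eq_bigr => q _.
  under eq_bigr do rewrite sum_a scaler_sumr.
  rewrite exchange_big; apply: eq_bigr => r _.
  under eq_bigr do rewrite sum_a scaler_sumr.
  rewrite exchange_big; apply: eq_bigr => l _; apply: eq_bigr => i _.
  by rewrite linearZ scalerA.
(* Making Q the outer index gives the form of [sum_nested_compositions], with (q, r, p) in the place
   of (p, q, r). *)
under eq_bigr do rewrite big_mkcond.
rewrite exchange_big; under eq_bigr do rewrite -big_mkcond.
rewrite sum_nested_compositions // => [|Q p r]; last by rewrite /H big_geq.
under eq_bigr do (under eq_bigr do rewrite big_mkcond; rewrite exchange_big).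
rewrite exchange_big; apply: eq_bigr => p _; apply: eq_bigr => q _.
rewrite [RHS]big_mkcond; apply: eq_bigr => r _.
rewrite [(q + r + p)%N]addnC addnA; case: ifP => // _.
by rewrite exchange_big.
Qed.

(** Parallel insertions commute: this is [coassoc_right] at j = a + q - 1, with the ungraded swap
    replaced by t at the cost of the sign. *)
Lemma flip23_left_term n p q r a i (x : C n) :
    (p + q + r = n.+2)%N -> (0 < i < a)%N -> (a <= p)%N ->
  t (left_term (p + r).-1 p r q a i x) =
  sgn ((r%:Z - 1) * (q%:Z - 1)) *: left_term (p + q).-1 p q r i (a + q).-1 x.
Proof.
move=> pqr ia ap; have e : n = (p + q + r).-2 by lia.
rewrite {}e in x *.
have ip : (0 < i <= p)%N by lia.
have ja : (i + q <= (a + q).-1 < p + q)%N by lia.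
have := coassoc_right (p := p) (q := q) (r := r) x ip ja.
have -> : ((a + q).-1 - q).+1 = a by lia.
move/(congr1 (@tassocV _ _ _ _)); rewrite tassocK /left_term => ->.
elim/(@tensor_ind k): (tmap (cocomp C _ p r a) idfun _) => [|z w y IH]; first by rewrite !linear0.
rewrite !linearD /= {}IH ?scalerDr; congr (_ + _).
elim/(@tensor_ind k): z => [|u v z IH]; first by rewrite pure0l !linear0.
rewrite pureDl !linearD /= {}IH ?scalerDr; congr (_ + _).
rewrite tassocE !tmapE /= tswapE tassocVE !tmapE /=.
by rewrite (@flip23E k nat C deg) tmapE.
Qed.

(** This is the nested case [coassoc_inner], at j = l + i - 1. *)
Lemma left_term_inner n p q r i l (x : C n) :
    (p + q + r = n.+2)%N -> (0 < i <= p)%N -> (0 < l <= q)%N ->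
  left_term (p + q).-1 p q r i (l + i).-1 x = right_term (q + r).-1 p q r i l x.
Proof.
move=> pqr ip lq; have e : n = (p + q + r).-2 by lia.
rewrite {}e in x *.
have ij : (i <= (l + i).-1 < i + q)%N by lia.
have := coassoc_inner (p := p) (q := q) (r := r) x ip ij.
have -> : ((l + i).-1 - i).+1 = l by lia.
rewrite /right_term => <-; rewrite /left_term.
elim/(@tensor_ind k): (tmap (cocomp C _ p q i) idfun _) => [|z w y IH]; first by rewrite !linear0.
rewrite !linearD /= {}IH; congr (_ + _).
elim/(@tensor_ind k): z => [|u v z IH]; first by rewrite pure0l !linear0.
rewrite pureDl !linearD /= {}IH; congr (_ + _).
by rewrite tassocE !tmapE /= !tmapE tassocVE.
Qed.

(* A collects the summands of (b ⊗ id) b whose first cocomposition is at an index i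
   smaller than the index a of the second one; t A is the sum of those whose two
   insertions are in the opposite order, and the remaining, nested, ones form
   (id ⊗ b) b. *)
Lemma cobrace_pre_Lie x : exists A,
  tmap b idfun (b x) - tassocV (tmap idfun b (b x)) = A + t A.
Proof.
elim/(@dsum_ind k): x => [|n x y [A IH]]; first by exists 0; rewrite !linear0.
suff [B eB] : exists B,
    tmap b idfun (b (dinj x)) - tassocV (tmap idfun b (b (dinj x))) = B + t B.
  by exists (B + A); rewrite !linearD /= addrACA eB IH addrACA.
pose N := n.+3.
pose L p q r := \sum_(1 <= a < p.+1) \sum_(1 <= i < a)
  (ins (p + q).-1 r i * ins p q a) *: left_term (p + q).-1 p q r a i x.
exists (\sum_(p < N) \sum_(q < N) \sum_(r < N | (p + q + r == n.+2)%N) L p q r).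
rewrite (cobrace_left_iterate (N := N)) // (cobrace_right_iterate (N := N)) //.
apply/eqP; rewrite subr_eq; apply/eqP.
rewrite linear_sum -!big_split; apply: eq_bigr => p _ /=.
rewrite linear_sum /=.
(* As t exchanges the pieces of arities q and r, these two indices are renamed before comparing
   summand by summand. *)
have -> : \sum_(q < N) t (\sum_(r < N | (p + q + r == n.+2)%N) L p q r) =
    \sum_(q < N) \sum_(r < N | (p + q + r == n.+2)%N) t (L p r q).
  under eq_bigr do rewrite linear_sum big_mkcond.
  rewrite exchange_big; apply: eq_bigr => r _ /=; rewrite [RHS]big_mkcond.
  by apply: eq_bigr => q _; rewrite addnAC.
rewrite -!big_split; apply: eq_bigr => q _ /=.
rewrite -!big_split; apply: eq_bigr => r /eqP pqr /=.
rewrite sum_split_insertions addrAC; congr (_ + _ + _); last first.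
  apply: eq_big_nat => i ip; apply: eq_big_nat => l lq.
  rewrite left_term_inner //; congr (_ *: _); rewrite -!sgnD; congr (Defs.sgn _).
  have -> : (p + q).-1%:Z = p%:Z + q%:Z - 1 by lia.
  have -> : (q + r).-1%:Z = q%:Z + r%:Z - 1 by lia.
  have -> : (l + i).-1%:Z = l%:Z + i%:Z - 1 by lia.
  ring.
rewrite linear_sum; apply: eq_big_nat => a ap /=.
rewrite linear_sum; apply: eq_big_nat => i ia /=.
rewrite linearZ /= flip23_left_term //; [|lia..].
rewrite scalerA; congr (_ *: _); rewrite -!sgnD.
have -> : (p + q).-1%:Z = p%:Z + q%:Z - 1 by lia.
have -> : (p + r).-1%:Z = p%:Z + r%:Z - 1 by lia.
have -> : (a + q).-1%:Z = a%:Z + q%:Z - 1 by lia.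
(* The two exponents differ by 2(q - 1)(r - 1). *)
rewrite -[LHS]mulr1 -(sgn_double ((q%:Z - 1) * (r%:Z - 1))) -sgnD; congr (Defs.sgn _).
ring.
Qed.

End Cobrace.

(** * Homogeneous elements for the suspended grading *)

Section Homogeneous.
Context {k : comPzRingType} {M : nat -> lmodType k}.
Local Notation L := (dsum M).
Local Notation deg := (fun n : nat => n%:Z - 1).

Lemma homogeneous_dinj n (a : M n) : homogeneous deg (n%:Z - 1) (dinj a).
Proof.
move=> i; have [<-//|ni] := eqVneq n i.
by rewrite /= eqtype.dfwith_out ?eqxx.
Qed.

(** The degree n - 1 determines the arity n, so only one piece can be nonzero, and none below degree
    -1. *)
Lemma homogeneousP m (x : L) : homogeneous deg m x ->
  x = 0 \/ exists n (a : M n), m = n%:Z - 1 /\ x = dinj a.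
Proof.
move=> hx; have [m0|m0] := Order.TotalTheory.leP 0 (m + 1); [right|left].
  exists (absz (m + 1)), (x (absz (m + 1))); split; first by lia.
  apply: dsumP => i /=; have [<-|ni] := eqVneq (absz (m + 1)) i.
    by rewrite eqtype.dfwith_in.
  rewrite eqtype.dfwith_out //; have [//|/hx] := eqVneq (x i) 0; lia.
by apply: dsumP => i; have [//|/hx] := eqVneq (x i) 0; lia.
Qed.

Lemma tensor_homogeneous0 m : tensor_homogeneous deg m (0 : tensor L L).
Proof. by exists [::] => //; rewrite big_nil. Qed.

Lemma tensor_homogeneousD m (x y : tensor L L) :
  tensor_homogeneous deg m x -> tensor_homogeneous deg m y ->
  tensor_homogeneous deg m (x + y).
Proof.
move=> [r -> hr] [r' -> hr']; exists (r ++ r'); first by rewrite big_cat.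
by move=> z; rewrite mem_cat => /orP[/hr|/hr'].
Qed.

Lemma tensor_homogeneousZ m c (x : tensor L L) :
  tensor_homogeneous deg m x -> tensor_homogeneous deg m (c *: x).
Proof.
move=> [r -> hr]; exists [seq (c *: z.1, z.2) | z <- r].
  by rewrite big_map scaler_sumr; apply: eq_bigr => z _; rewrite pureZl.
move=> _ /mapP[z /hr[a h1 h2] ->]; exists a => //=.
move=> i ci; apply: h1; apply: contra_neq ci => z0.
by apply: (etrans (congr1 _ z0)); apply: scaler0.
Qed.

Lemma tensor_homogeneous_pure p q (u : M p) (v : M q) :
  tensor_homogeneous deg (p%:Z - 1 + (q%:Z - 1)) (pure (dinj u) (dinj v)).
Proof.
exists [:: (dinj u, dinj v)]; first by rewrite big_seq1.
move=> z; rewrite inE => /eqP->; exists (p%:Z - 1) => /=.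
  exact: homogeneous_dinj.
by rewrite addrC addKr; apply: homogeneous_dinj.
Qed.

End Homogeneous.

(** * The cobracket, the differential and the dg Lie coalgebra axioms *)

Section Cobracket.
Context {k : comPzRingType} (C : cooperad_with_comult k).
Local Notation T := (dsum C).
Local Notation sgn := (@sgn k).
Local Notation deg := (fun n : nat => n%:Z - 1).
Local Notation tau := (graded_flip deg (M := C)).
Local Notation s := (flip12 deg (M := C)).
Local Notation t := (flip23 deg (M := C)).
Local Notation ins p q i := (sgn ((q%:Z - 1) * (p%:Z - i%:Z))).
Local Notation b := (cobrace C).
Local Notation c := (cobracket C).
Local Notation d := (differential C).

Lemma linear_cobrace_dinj (W : lmodType k) (f : {linear tensor T T -> W}) n N
    (x : C n) : (n.+1 < N)%N ->
  f (b (dinj x)) = \sum_(p < N) \sum_(q < N | (p + q == n.+1)%N)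
    \sum_(1 <= i < p.+1) ins p q i *: f (tmap dinj dinj (cocomp C n p q i x)).
Proof.
move=> nN; rewrite (cobrace_dinj x nN).
do 3![rewrite linear_sum; apply: eq_bigr => ? _].
exact: linearZ.
Qed.

Lemma flip_block m p q (a : C m) (w : tensor (C p) (C q)) :
  t (s (tassocV (pure (dinj a) (tmap dinj dinj w)))) =
  sgn ((m%:Z - 1) * (p%:Z - 1) + (m%:Z - 1) * (q%:Z - 1)) *:
    pure (tmap dinj dinj w) (dinj a).
Proof.
elim/(@tensor_ind k): w => [|u v w IH].
  by rewrite !linear0 pure0r pure0l !linear0.
rewrite !linearD pureDl pureDr !linearD /= {}IH ?scalerDr; congr (_ + _).
rewrite tmapE tassocVE (@flip12E k nat C deg) linearZ /= (@flip23E k nat C deg).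
by rewrite scalerA -sgnD.
Qed.

(** The cobrace preserves degree, n - 1 = (p - 1) + (q - 1), so flipping a ⊗ x before splitting x
    costs the same sign as carrying a past both pieces of x. *)
Lemma tmap_cobrace_flip z :
  tmap b idfun (tau z) = t (s (tassocV (tmap idfun b z))).
Proof.
move: z; apply: (tensor_dsum_ext (f := tmap b idfun \o tau)
  (g := t \o (s \o (@tassocV k T T T \o tmap idfun b)))) => m n a x /=.
rewrite (@graded_flipE k nat C deg) linearZ /= !tmapE /= (cobrace_dinj x (ltnSn _)).
have sum_a := linear_sum (@tassocV k T T T).
have sum_s := linear_sum s; have sum_t := linear_sum t.
rewrite pure_suml_cond pure_sumr_cond sum_a sum_s sum_t scaler_sumr.
apply: eq_bigr => p _ /=.
rewrite pure_suml_cond pure_sumr_cond sum_a sum_s sum_t scaler_sumr.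
apply: eq_bigr => q /eqP pq /=.
rewrite pure_suml_cond pure_sumr_cond sum_a sum_s sum_t scaler_sumr.
apply: eq_bigr => i _ /=.
rewrite pureZl pureZr !linearZ /= flip_block.
rewrite !scalerA -!sgnD; congr (Defs.sgn _ *: _).
have -> : n%:Z = p%:Z + q%:Z - 1 by lia.
ring.
Qed.

Lemma tmap_cobrace_flipV z :
  tassocV (tmap idfun b (tau z)) = s (t (tmap b idfun z)).
Proof.
rewrite -[in RHS](@graded_flipK k nat C deg z) tmap_cobrace_flip.
by rewrite flip23K flip12K.
Qed.

Lemma tmap_cobracket_l z : tmap c idfun z = tmap b idfun z - s (tmap b idfun z).
Proof.
elim/(@tensor_ind k): z => [|u v z IH]; first by rewrite !linear0 ?addr0.
rewrite !linearD /= {}IH ?opprD addrACA; congr (_ + _).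
by rewrite !tmapE /= /cobracket pureBl /flip12 tmapE.
Qed.

Lemma tmap_cobracket_r z (y := tassocV (tmap idfun b z)) :
  tassocV (tmap idfun c z) = y - t y.
Proof.
rewrite {}/y; elim/(@tensor_ind k): z => [|u v z IH]; first by rewrite !linear0 ?addr0.
rewrite !linearD /= {}IH ?opprD addrACA; congr (_ + _).
rewrite !tmapE /= /flip23 /= tassocVK tmapE /= /cobracket.
by rewrite pureBr linearB.
Qed.

Section Iterates.
Variable x : T.
Local Notation X := (tmap b idfun (b x)).
Local Notation Y := (tassocV (tmap idfun b (b x))).

Lemma cobracket_left_iterate (u := X - t (s Y)) : tmap c idfun (c x) = u - s u.
Proof. by rewrite tmap_cobracket_l /cobracket linearB /= tmap_cobrace_flip. Qed.

Lemma cobracket_right_iterate (u := Y - s (t X)) :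
  tassocV (tmap idfun c (c x)) = u - t u.
Proof.
rewrite tmap_cobracket_r /cobracket /u -tmap_cobrace_flipV.
by rewrite [tmap idfun b (_ - _)]linearB [tassocV (_ - _)]linearB.
Qed.

Lemma flip23_cobrace_associator : t (X - Y) = X - Y.
Proof.
by have [A ->] := cobrace_pre_Lie x; rewrite linearD /= flip23K addrC.
Qed.

End Iterates.

Definition comult_comp n : {linear C n -> k^o} :=
  match n with 2 => comult C | _ => \0 end.

Definition comult_ext : T -> k^o := dlift comult_comp.
HB.instance Definition _ := GRing.Linear.on comult_ext.
Local Notation mu := comult_ext.

Lemma comult_ext_dinj n (a : C n) : mu (dinj a) = comult_comp n a.
Proof. exact: dlift_inj. Qed.

Lemma comult_comp0 n (a : C n) : n != 2%N -> comult_comp n a = 0.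
Proof. by case: n a => [|[|[|n]]]. Qed.

Lemma lunit_tmap_comult p q (w : tensor (C p) (C q)) :
  lunit (tmap mu idfun (tmap dinj dinj w)) =
  dinj (lunit (tmap (comult_comp p) idfun w)).
Proof.
elim/(@tensor_ind k): w => [|u v w IH]; first by rewrite !linear0.
rewrite !linearD /= {}IH; congr (_ + _).
by rewrite !tmapE /= !lunitE comult_ext_dinj linearZ.
Qed.

Lemma lunit_tmap_comult_flip p q (w : tensor (C p) (C q)) :
  lunit (tmap mu idfun (tau (tmap dinj dinj w))) =
  sgn ((p%:Z - 1) * (q%:Z - 1)) *: dinj (runit (tmap idfun (comult_comp q) w)).
Proof.
elim/(@tensor_ind k): w => [|u v w IH]; first by rewrite !linear0.
rewrite !linearD /= {}IH ?scalerDr; congr (_ + _).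
rewrite !tmapE (@graded_flipE k nat C deg) !linearZ /= tmapE /= lunitE runitE.
by rewrite comult_ext_dinj [in RHS]linearZ.
Qed.

Lemma lunit_tmap_comult2 p q (w : tensor (C p) (C q)) :
  lunit (tmap mu mu (tmap dinj dinj w)) = lunit (tmap (comult_comp p) (comult_comp q) w).
Proof.
elim/(@tensor_ind k): w => [|u v w IH]; first by rewrite !linear0.
rewrite !linearD /= {}IH; congr (_ + _).
by rewrite !tmapE /= ?tmapE /= !comult_ext_dinj.
Qed.

(** Only p = q = 2, hence n = 3, contributes, and its two insertion positions carry opposite
    signs. *)
Lemma comult_cobrace x : lunit (tmap mu mu (b x)) = 0 :> k^o.
Proof.
elim/(@dsum_ind k): x => [|n x y IH]; first by rewrite !linear0.
rewrite !linearD /= {}IH addr0.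
apply: (etrans (linear_cobrace_dinj (@lunit k k^o \o tmap mu mu) x (ltnSn _))); rewrite /=.
have [n3|n3] := eqVneq n 3; last first.
  apply: big1 => p _; apply: big1 => q /eqP pq; apply: big1 => i _.
  rewrite lunit_tmap_comult2.
  have [p2|p2] := eqVneq (p : nat) 2%N; last first.
    by rewrite tmap0l ?linear0 ?scaler0 // => a; apply: comult_comp0.
  rewrite tmap0r ?linear0 ?scaler0 // => a; apply: comult_comp0; lia.
rewrite {}n3 in x *.
rewrite (sum_arity_at (p0 := 2) (q0 := 2)
  (f := fun p q => \sum_(1 <= i < p.+1)
    ins p q i *: lunit (tmap mu mu (tmap dinj dinj (cocomp C 3 p q i x))))) //.
  rewrite big_nat_recr // big_nat1 /= !lunit_tmap_comult2 /= comult_coassoc.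
  by rewrite -scalerDl (sgnE (n := 1)) // (sgnE (n := 0)) // expr1 expr0 addNr scale0r.
move=> p q _ p2; apply: big1 => i _; rewrite lunit_tmap_comult2.
by rewrite tmap0l ?linear0 ?scaler0 // => a; apply: comult_comp0.
Qed.

Lemma lunit_tmap_cobrace n (x : C n.+1) :
  lunit (tmap mu idfun (b (dinj x))) =
  dinj (lunit (tmap (comult C) idfun
    (cocomp C n.+1 2 n 2 x + (-1) ^+ n.+1 *: cocomp C n.+1 2 n 1 x))).
Proof.
apply: (etrans (linear_cobrace_dinj (@lunit k T \o tmap mu idfun) x (ltnSn _))); rewrite /=.
rewrite (sum_arity_at (p0 := 2) (q0 := n)
  (f := fun p q => \sum_(1 <= i < p.+1) ins p q i *:
    lunit (tmap mu idfun (tmap dinj dinj (cocomp C n.+1 p q i x))))) //; last first.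
  move=> p q _ p2; apply: big1 => i _; rewrite lunit_tmap_comult.
  by rewrite tmap0l ?linear0 ?scaler0 // => a; apply: comult_comp0.
rewrite big_nat_recr // big_nat1 /= !lunit_tmap_comult /=.
(* At i = 1 the exponent is n - 1, which has the parity of the arity n + 1 of x. *)
rewrite (sgnE (n := n.+1)); last by lia.
rewrite (sgnE (n := 0)); last by lia.
by rewrite expr0 scale1r !linearD !linearZ /= addrC.
Qed.

Lemma lunit_tmap_cobrace_flip n (x : C n.+1) :
  lunit (tmap mu idfun (tau (b (dinj x)))) =
  - dinj (\sum_(1 <= i < n.+1) (-1) ^+ i *:
      runit (tmap idfun (comult C) (cocomp C n.+1 n 2 i x))).
Proof.
apply: (etrans (linear_cobrace_dinj (@lunit k T \o (tmap mu idfun \o tau)) x (ltnSn _))).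
rewrite /=.
rewrite (sum_arity_at (p0 := n) (q0 := 2)
  (f := fun p q => \sum_(1 <= i < p.+1) ins p q i *:
    lunit (tmap mu idfun (tau (tmap dinj dinj (cocomp C n.+1 p q i x)))))) //; first last.
- move=> p q pq pn; apply: big1 => i _; rewrite lunit_tmap_comult_flip.
  by rewrite tmap0r ?linear0 ?scaler0 // => a; apply: comult_comp0; lia.
- by rewrite addn2.
rewrite linear_sum -sumrN; apply: eq_big_nat => i ip.
(* The flip contributes n - 1 and the cobrace n - i, together the parity of i + 1; hence the overall
   minus sign. *)
rewrite lunit_tmap_comult_flip /= scalerA -sgnD (sgnE (n := i.+1)); last by lia.
by rewrite exprS mulN1r scaleNr !linearZ.
Qed.

(** The cobrace yields the two outer terms of d, where mu meets the first factor; its flip yields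
    the inner sum. *)
Lemma differentialE x : d x = lunit (tmap mu idfun (c x)).
Proof.
elim/(@dsum_ind k): x => [|n x y IH]; first by rewrite !linear0.
rewrite (linearD d) (linearD c) (linearD (tmap mu idfun)) (linearD (@lunit k T)) /= IH.
congr (_ + _); rewrite /cobracket [d _]dlift_inj !linearB /=.
case: n x => [|n] x.
  (* In arity 0 only (p, q) = (1, 0) has an insertion position, and mu vanishes on both C(1) and
     C(0). *)
  have f0 (W : lmodType k) (f : {linear tensor T T -> W}) :
      f (tmap dinj dinj (cocomp C 0 1 0 1 x)) = 0 -> f (b (dinj x)) = 0.
    move=> fx; rewrite (linear_cobrace_dinj f x (ltnSn _)).
    rewrite (sum_arity_at (p0 := 1) (q0 := 0)
      (f := fun p q => \sum_(1 <= i < p.+1)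
         ins p q i *: f (tmap dinj dinj (cocomp C 0 p q i x)))) //.
      by rewrite big_nat1 fx scaler0.
    by case=> [|[|p]] q // _ _; rewrite big_geq.
  have -> : lunit (tmap mu idfun (b (dinj x))) = 0.
    apply: (f0 _ (@lunit k T \o tmap mu idfun)).
    by rewrite /= lunit_tmap_comult tmap0l ?linear0.
  have -> : lunit (tmap mu idfun (tau (b (dinj x)))) = 0.
    apply: (f0 _ (@lunit k T \o (tmap mu idfun \o tau))).
    by rewrite /= lunit_tmap_comult_flip tmap0r ?linear0 ?scaler0.
  by rewrite /diff_comp /= linear0 subr0.
by rewrite lunit_tmap_cobrace lunit_tmap_cobrace_flip opprK -linearD.
Qed.

Lemma cobracket_flip x : tau (c x) = - c x.
Proof. by rewrite /cobracket linearB /= (@graded_flipK k nat C deg) opprB. Qed.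

(** The support C(2) of mu has odd degree 1, so mu ⊗ mu changes sign under the graded flip. *)
Lemma flip12_comult2 z :
  lunit (tmap (@lunit k k^o \o tmap mu mu) idfun (s z)) =
  - lunit (tmap (@lunit k k^o \o tmap mu mu) idfun z).
Proof.
pose e := @lunit k T \o tmap (@lunit k k^o \o tmap mu mu) idfun.
move: z; apply: (tensor3_dsum_ext (f := e \o s) (g := -%R \o e)) => i j l u v w /=.
rewrite (@flip12E k nat C deg) linearZ /= /e /= !tmapE /= !tmapE !lunitE.
rewrite linearZ /= lunitE !comult_ext_dinj scalerA -scaleNr; congr (_ *: _).
have [i2|i2] := eqVneq i 2%N; last by rewrite (comult_comp0 u) // !(mulr0, scaler0, scale0r, oppr0).
have [j2|j2] := eqVneq j 2%N; last by rewrite (comult_comp0 v) // !(mulr0, scaler0, scale0r, oppr0).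
by rewrite i2 j2 in u v *; rewrite (sgnE (n := 1)) // expr1 mulN1r [_ *: _]mulrC.
Qed.

Lemma differential_square x : d (d x) = 0.
Proof.
pose e := @lunit k T \o tmap (@lunit k k^o \o tmap mu mu) idfun.
have eb z : e (tmap b idfun z) = 0.
  rewrite /e; elim/(@tensor_ind k): z => [|u v z IH]; first by rewrite !linear0.
  by rewrite !linearD /= in IH *; rewrite IH addr0 !tmapE /= comult_cobrace pure0l linear0.
have e_assoc u y : mu u *: lunit (tmap mu idfun y) = e (tassocV (pure u y)).
  rewrite /e; elim/(@tensor_ind k): y => [|v w y IH].
    by rewrite pure0r !linear0.
  rewrite pureDr !linearD /= {}IH; congr (_ + _).
  by rewrite tassocVE !tmapE /= tmapE !lunitE scalerA.
(* Contractions of different factors commute, so d d becomes [e] applied to (1 ⊗ c) c. *)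
have ec (g : {linear T -> tensor T T}) w :
    lunit (tmap mu idfun (g (lunit (tmap mu idfun w)))) = e (tassocV (tmap idfun g w)).
  rewrite /e; elim/(@tensor_ind k): w => [|u v w IH]; first by rewrite !linear0.
  rewrite !linearD /= {}IH; congr (_ + _).
  by rewrite !tmapE /= lunitE !linearZ /=; apply: e_assoc.
rewrite !differentialE (ec c) cobracket_right_iterate.
have [A XY] := cobrace_pre_Lie x.
apply: (pre_Lie_square (s := s) (t := t)
  (e := @lunit k T \o tmap (@lunit k k^o \o tmap mu mu) idfun)
  (@flip_braid k nat C deg) (flip23_cobrace_associator x) flip12_comult2 XY).
  exact: eb.
(* Here t s Y is again of the form (b ⊗ 1) z, with z the flipped cobrace. *)
by rewrite /= -tmap_cobrace_flip; apply: eb.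
Qed.

Lemma differential_coderivation x :
  c (d x) = tmap d idfun (c x) + tau (tmap d idfun (tau (c x))).
Proof.
(* This is mu ⊗ 1 ⊗ 1; it intertwines t with the flip of the two remaining factors. *)
pose e := @lunit k (tensor T T) \o (tmap mu idfun \o @tassoc k T T T).
have ec (g : {linear T -> tensor T T}) w :
    g (lunit (tmap mu idfun w)) = e (tassocV (tmap idfun g w)).
  rewrite /e /= tassocVK.
  elim/(@tensor_ind k): w => [|u v w IH]; first by rewrite !linear0.
  rewrite !linearD /= {}IH; congr (_ + _).
  by rewrite !tmapE /= !lunitE linearZ.
have e_assoc y v : pure (lunit (tmap mu idfun y)) v = e (pure y v).
  rewrite /e; elim/(@tensor_ind k): y => [|u w y IH].
    by rewrite !linear0 !pure0l linear0.
  rewrite pureDl !linearD pureDl /= {}IH; congr (_ + _).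
  by rewrite tassocE !tmapE !lunitE pureZl.
have ed (f : {linear T -> T}) (g : {linear T -> tensor T T}) w :
    (forall v, f v = lunit (tmap mu idfun (g v))) -> tmap f idfun w = e (tmap g idfun w).
  move=> fg; rewrite /e; elim/(@tensor_ind k): w => [|u v w IH]; first by rewrite !linear0.
  rewrite !linearD /= {}IH; congr (_ + _).
  by rewrite !tmapE fg; apply: e_assoc.
have et z : tau (e z) = e (t z).
  rewrite /e /flip23 /= tassocVK.
  elim/(@tensor_ind k): (tassoc z) => [|u v w IH]; first by rewrite !linear0.
  rewrite !linearD /= {}IH; congr (_ + _).
  by rewrite !tmapE !lunitE linearZ.
(* Since tau c = - c, both sides become [e] applied to the two sides of [pre_Lie_coderivation]. *)
rewrite cobracket_flip !linearN /= (ed d c _ differentialE) et differentialE (ec c) -linearB.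
rewrite cobracket_left_iterate cobracket_right_iterate; congr e.
by apply: (pre_Lie_coderivation (s := s) (t := t));
  [exact: flip23K | exact: flip_braid | exact: flip23_cobrace_associator].
Qed.

Lemma differential_degree m x :
  homogeneous deg m x -> homogeneous deg (m - 1) (d x).
Proof.
move=> /homogeneousP[->|[n [a [-> ->]]]] i; first by rewrite linear0 eqxx.
have -> : d (dinj a) = dinj (diff_comp a) := dlift_inj _ _.
(* At n = 0 the truncated [n.-1] would give the wrong degree, but there d is zero. *)
case: n a => [|n] a.
  by rewrite /diff_comp eqxx linear0 eqxx.
move=> /homogeneous_dinj ->; lia.
Qed.

Lemma cobracket_degree m x :
  homogeneous deg m x -> tensor_homogeneous deg m (c x).
Proof.
move=> /homogeneousP[->|[n [a [-> ->]]]].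
  by rewrite linear0; apply: tensor_homogeneous0.
rewrite /cobracket -scaleN1r.
(* Stated for a general [g] to serve both the cobrace and its flip. *)
have h (g : {linear tensor T T -> tensor T T}) :
  (forall p q (u : C p) (v : C q), (p + q = n.+1)%N ->
    tensor_homogeneous deg (n%:Z - 1) (g (pure (dinj u) (dinj v)))) ->
  tensor_homogeneous deg (n%:Z - 1) (g (b (dinj a))).
  move=> hg; rewrite (linear_cobrace_dinj g a (ltnSn _)).
  apply: big_ind => [||p _]; [exact: tensor_homogeneous0|exact: tensor_homogeneousD|].
  apply: big_ind => [||q /eqP pq]; [exact: tensor_homogeneous0|exact: tensor_homogeneousD|].
  apply: big_ind => [||i _]; [exact: tensor_homogeneous0|exact: tensor_homogeneousD|].
  apply: tensor_homogeneousZ.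
  elim/(@tensor_ind k): (cocomp C n p q i a) => [|u v w IH].
    by rewrite !linear0; apply: tensor_homogeneous0.
  by rewrite !linearD /=; apply: tensor_homogeneousD => //; rewrite tmapE; apply: hg.
have degE p q : (p + q = n.+1)%N -> n%:Z - 1 = p%:Z - 1 + (q%:Z - 1) by lia.
apply: tensor_homogeneousD.
  apply: (h idfun) => p q u v /degE ->; exact: tensor_homogeneous_pure.
apply: tensor_homogeneousZ; apply: (h tau) => p q u v /degE ->.
rewrite /= (@graded_flipE k nat C deg); apply: tensor_homogeneousZ.
by rewrite addrC; apply: tensor_homogeneous_pure.
Qed.

End Cobracket.

Theorem corollary3p5 (k : comPzRingType) (C : cooperad_with_comult k) :
  dg_Lie_coalgebra (fun n : nat => n%:Z - 1) C (differential C) (cobracket C).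
Proof.
split=> [m x|x|m x|x|x|x y].
- exact: differential_degree.
- exact: differential_square.
- exact: cobracket_degree.
- exact: differential_coderivation.
(* Unfolding shows that [rho] is the graded flip for the degree n - 1. *)
- by exists (cobrace C x).
- rewrite {}/y cobracket_left_iterate.
  pose deg := fun n : nat => n%:Z - 1.
  by apply: (pre_Lie_Jacobi (s := flip12 deg (M := C)) (t := flip23 deg (M := C)));
    [exact: flip12K | exact: flip23K | exact: flip_braid | exact: flip23_cobrace_associator].
Qed.
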